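(* For all integers $t\ge 2$ and $k\ge 2$, $$\lim_{n\to \infty}\frac{U_{t+1}(n,tk)}{n^k}=\frac{1}{k!}\cdot \frac{1}{\binom{tk-1}{k-1}}.$$
   Context: An $r$-graph on a vertex set $V$ is a family of distinct $r$-element subsets of $V$ (its edges). For a positive integer $s$, an $r$-graph $\mathcal{H}$ is called $s$-union-free if for arbitrary two distinct subsets $\mathcal{A},\mathcal{B}\subseteq\mathcal{H}$, each consisting of at most $s$ edges, it holds that $\bigcup_{A\in\mathcal{A}} A\neq \bigcup_{B\in\mathcal{B}} B$. $U_s(n,r)$ denotes the maximum number of edges that can be contained in an $s$-union-free $r$-graph on $n$ vertices. *)

(* Defs.v *)
From mathcomp Require Import all_boot.

Set Implicit Arguments.
Unset Strict Implicit.
Unset Printing Implicit Defensive.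

Definition rgraph (V : finType) (r : nat) (H : {set {set V}}) : bool :=
  [forall e in H, #|e| == r].

(* The subfamilies A and B need not be disjoint and may be empty. *)
Definition union_free (V : finType) (s : nat) (H : {set {set V}}) : bool :=
  [forall A : {set {set V}}, forall B : {set {set V}},
    [&& A \subset H, B \subset H, #|A| <= s, #|B| <= s & A != B]
      ==> (cover A != cover B)].

(* The empty r-graph is s-union-free, so the maximum is over a nonempty
   family and the default value 0 of \max plays no role. *)
Definition U (s n r : nat) : nat :=
  \max_(H : {set {set 'I_n}} | rgraph r H && union_free s H) #|H|.

(* Main.v *)
(** Upper bound.  Call a k-subset of an edge A "own" if no other edge contains
    it.  If the blocks of a partition of A into t k-sets are all non-own, then A
    is covered by t other edges, and adding A to these t edges does not change
    their union.  Hence every partition has an own block, and averaging over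
    partitions gives each edge at least C(tk-1,k-1) own k-sets; own k-sets of
    distinct edges are distinct.

    Lower bound.  A gadget is a family of edges B + x_B, where B runs through a
    family of (tk-1)-sets whose k-shadow is much smaller than the family, and
    the vertices x_B are private.  Nearly all k-sets in the shadow of the gadget
    contain some x_B, and each edge has C(tk-1,k-1) of these.  It remains to pack
    n vertices with copies of the gadget whose k-shadows are disjoint and cover
    almost all k-sets, in such a way that every few copies overlap no more than
    in a tree-like configuration, and that the k-sets inside a copy but outside
    its shadow are in no shadow at all.  For the last point a random sparse
    family X of k-sets is sacrificed beforehand: shadows avoid X and non-shadows
    lie in X.

    The packing comes from a Roedl nibble that only uses expectations: after
    each round, the events "T is uncovered" for boundedly many k-sets T are
    asymptotically independent, uniformly in the choice of the k-sets.  This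
    statement reproduces itself, because applied to two copies that meet in a
    single k-set it bounds the variance of the number of usable copies at T. *)

Require Import Defs.
From HB Require Import structures.
From mathcomp Require Import all_boot all_order all_algebra perm.
From mathcomp Require Import zify ring lra.

Set Implicit Arguments.
Unset Strict Implicit.
Unset Printing Implicit Defensive.

Import Order.TTheory GRing.Theory Num.Theory.

(** * Counting by sums and the deletion method *)

Lemma card_set_sum (T : finType) (Q : pred T) : #|[set x | Q x]| = \sum_x Q x.
Proof.
by rewrite -sum1dep_card big_mkcond; apply: eq_bigr => x _; case: (Q x).
Qed.

Lemma card_bigcup_le (I T : finType) (P : pred I) (F : I -> {set T}) :
  (#|\bigcup_(i | P i) F i| <= \sum_(i | P i) #|F i|).
Proof.
elim/big_ind2: _ => [|i A j B Ai Bj|//]; first by rewrite cards0.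
by rewrite (leq_trans (leq_card_setU A B)) ?leq_add.
Qed.

(** The deletion step of the probabilistic method: one point of each bad set inside [Y] is removed.
    Such a point exists because no bad set is empty. *)
Lemma remove_bad (C : finType) (Y : {set C}) (ZZ : {set {set C}}) : set0 \notin ZZ ->
  exists Y' : {set C}, [/\ Y' \subset Y, forall Z, Z \in ZZ -> ~~ (Z \subset Y') &
    #|Y| <= #|Y'| + #|[set Z in ZZ | Z \subset Y]|].
Proof.
move=> Z0; have [Y0|[c0 _]] := set_0Vmem Y.
  exists set0; rewrite sub0set Y0 cards0; split=> // Z ZZZ.
  by rewrite subset0; apply: contraNneq Z0 => <-.
pose pk (Z : {set C}) := odflt c0 [pick c in Z].
have pkZ Z : Z \in ZZ -> pk Z \in Z.
  move=> ZZZ; rewrite /pk; case: pickP => //= Zn; case/negP: Z0.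
  by rewrite (_ : set0 = Z) //; apply/setP => c; rewrite inE Zn.
pose bz := [set Z in ZZ | Z \subset Y].
exists (Y :\: pk @: bz); split; first exact: subsetDl.
  move=> Z ZZZ; apply/negP => ZM; have := subsetP ZM _ (pkZ _ ZZZ).
  rewrite in_setD => /andP[/negP pkN _]; apply: pkN; apply: imset_f; rewrite inE ZZZ.
  exact: subset_trans ZM (subsetDl _ _).
rewrite -(cardsID (pk @: bz) Y) addnC leq_add2l.
by rewrite (leq_trans _ (leq_imset_card pk _)) // subset_leq_card ?subsetIr.
Qed.

(** * Random copies of a finite set *)

Definition copy (I T : finType) := {f : {ffun I -> T} | injectiveb f}.

HB.instance Definition _ (I T : finType) := Finite.on (copy I T).

Definition copy_fun (I T : finType) (f : copy I T) : I -> T := val f.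
Coercion copy_fun : copy >-> Funclass.

Section Copies.
Variables (I T : finType).
Implicit Type (f : copy I T).

Lemma copy_inj f : injective f.
Proof. exact/injectiveP/(valP f). Qed.

Lemma card_copy : #|{: copy I T}| = #|T| ^_ #|I|.
Proof. by rewrite card_sig -card_inj_ffuns cardsE. Qed.

Lemma copy_eq f f' : f =1 f' -> f = f'.
Proof. by move=> ff'; apply/val_inj/ffunP. Qed.

Lemma card_copy_im f (A : {set I}) : #|f @: A| = #|A|.
Proof. exact/card_imset/copy_inj. Qed.

Lemma copy_im_inj f : injective (fun A : {set I} => f @: A).
Proof. exact/imset_inj/copy_inj. Qed.

Lemma comp_copy_subproof (s : {perm T}) f : injectiveb [ffun x => s (f x)].
Proof.
by apply/injectiveP => x y; rewrite !ffunE => /perm_inj/copy_inj.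
Qed.

Definition comp_copy s f : copy I T :=
  exist (fun u : {ffun I -> T} => injectiveb u) _ (comp_copy_subproof s f).

Lemma comp_copyE s f x : comp_copy s f x = s (f x).
Proof. by rewrite /copy_fun /= ffunE. Qed.

Lemma comp_copy_im s f (A : {set I}) : comp_copy s f @: A = s @: (f @: A).
Proof. by rewrite -imset_comp; apply: eq_imset => x; exact: comp_copyE. Qed.

End Copies.

(** Enumerate [A] followed by its complement, and [B] followed by its complement; matching the two
    lists position by position carries [A] onto [B]. *)
Lemma perm_setP (T : finType) (A B : {set T}) : #|A| = #|B| ->
  exists s : {perm T}, s @: A = B.
Proof.
move=> AB; pose l (X : {set T}) := enum X ++ enum (~: X).
have lmem X x : x \in l X by rewrite mem_cat !mem_enum inE orbN.
have luniq X : uniq (l X).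
  rewrite cat_uniq !enum_uniq andbT /=; apply/hasPn => x; rewrite !mem_enum.
  by rewrite inE.
have lsize : size (l A) = size (l B).
  by rewrite !size_cat -!cardE AB (cardsC B) -AB cardsC.
pose f x := nth x (l B) (index x (l A)).
have idx x : index x (l A) < size (l B) by rewrite -lsize index_mem.
have finj : injective f.
  move=> x y; rewrite /f (set_nth_default y) // => /eqP.
  rewrite nth_uniq // => /eqP exy.
  by rewrite -(nth_index x (lmem A x)) exy nth_index.
exists (perm finj); apply/eqP; rewrite eqEcard card_imset; last exact: perm_inj.
rewrite AB leqnn andbT; apply/subsetP => _ /imsetP[x xA ->]; rewrite permE /f.
rewrite index_cat mem_enum xA nth_cat.
have ix : index x (enum A) < size (enum B) by rewrite -cardE -AB cardE index_mem mem_enum.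
by rewrite ix -mem_enum mem_nth.
Qed.

Section Transitivity.
Variables (I T : finType) (w : nat) (F : {set {set I}}).
Hypothesis Fw : forall e, e \in F -> #|e| = w.

Definition copies_onto (W : {set T}) := [set f : copy I T | W \in [set f @: e | e : {set I} in F]].

Lemma copies_onto_le (W W' : {set T}) : #|W| = #|W'| -> #|copies_onto W| <= #|copies_onto W'|.
Proof.
move=> /perm_setP[s sW].
rewrite -(@card_imset _ _ (comp_copy s)); last first.
  move=> f f' ff'; apply: copy_eq => x; apply: (@perm_inj _ s).
  by rewrite -!comp_copyE ff'.
apply/subset_leq_card/subsetP => _ /imsetP[f + ->].
rewrite !inE => /imsetP[e eF We]; apply/imsetP; exists e => //.
by rewrite comp_copy_im -We sW.
Qed.

(** Double counting: permutations of [T] make the count the same for all [w]-sets, and a copy, being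
    injective on sets, hits exactly [#|F|] of them. *)
Lemma card_copies_onto (W : {set T}) : #|W| = w ->
  #|copies_onto W| * 'C(#|T|, w) = #|F| * (#|T| ^_ #|I|).
Proof.
move=> cW; rewrite mulnC.
transitivity (\sum_(W' : {set T} | #|W'| == w) #|copies_onto W'|).
  rewrite (eq_bigr (fun=> #|copies_onto W|)).
    by rewrite sum_nat_const -(card_draws T w) cardsE.
  by move=> W' /eqP W'w; apply/eqP; rewrite eqn_leq !copies_onto_le ?cW ?W'w.
under eq_bigr do rewrite card_set_sum.
rewrite exchange_big /= -card_copy mulnC -sum_nat_const; apply: eq_bigr => f _.
rewrite -(card_imset F (@copy_im_inj _ _ f)) -sum1_card big_mkcond [RHS]big_mkcond /=.
apply: eq_bigr => W' _; case: (boolP (W' \in _)) => [/imsetP[e eF ->]|_]; last by rewrite if_same.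
by rewrite card_copy_im Fw // eqxx.
Qed.

End Transitivity.

(** A function with at most [s] values factors through ['I_s], by the index of the value in an
    enumeration of the image. *)
Lemma card_small_image (J T : finType) (s : nat) : 0 < #|T| ->
  #|[set f : {ffun J -> T} | #|f @: [set: J]| <= s]| <= s ^ #|J| * #|T| ^ s.
Proof.
move=> /card_gt0P[x0 _].
have -> : s ^ #|J| * #|T| ^ s = #|{: {ffun J -> 'I_s} * {ffun 'I_s -> T}}|.
  by rewrite card_prod !card_ffun !card_ord.
pose c (q : {ffun J -> 'I_s} * {ffun 'I_s -> T}) : {ffun J -> T} := [ffun j => q.2 (q.1 j)].
apply: leq_trans (leq_imset_card c _);
apply/subset_leq_card/subsetP => f; rewrite inE => fs.
have idx j : index (f j) (enum (f @: [set: J])) < s.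
  by apply: leq_trans fs; rewrite cardE index_mem mem_enum imset_f.
apply/imsetP; exists ([ffun j => Ordinal (idx j)], [ffun i : 'I_s => nth x0 (enum (f @: [set: J])) i]) => //.
by apply/ffunP => j; rewrite !ffunE /= nth_index // mem_enum imset_f.
Qed.

(** * Collections of copies with a small union *)

Section SmallUnions.
Variables (I T : finType).

Definition span (Z : {set copy I T}) := \bigcup_(f in Z) (copy_fun f @: [set: I]).

(** Listing the [j] copies of [Z] as rows gives a single function on ['I_j * I] whose image lies in
    [span Z]. This function determines [Z], so [card_small_image] bounds the count. *)
Lemma card_small_span (j s : nat) : 0 < #|T| ->
  #|[set Z : {set copy I T} | (#|Z| == j) && (#|span Z| <= s)]|
    <= s ^ (j * #|I|) * #|T| ^ s.
Proof.
move=> T0; have [s0|] := posnP #|[set Z : {set copy I T} | (#|Z| == j) && (#|span Z| <= s)]|.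
  by rewrite s0.
case/card_gt0P => Z0; rewrite inE => /andP[/eqP Z0j _].
have [j0|j_gt0] := posnP j.
  apply: (@leq_trans #|[set (set0 : {set copy I T})]|).
    by apply/subset_leq_card/subsetP => Z; rewrite !inE j0 cards_eq0 => /andP[].
  by rewrite cards1 j0 mul0n mul1n expn_gt0 T0.
have [f0 _] : exists f, f \in Z0 by apply/card_gt0P; rewrite Z0j.
have := card_small_image ('I_j * I)%type s T0.
rewrite card_prod card_ord; apply: leq_trans.
pose row (Z : {set copy I T}) i : copy I T := nth f0 (enum Z) i.
pose c Z : {ffun 'I_j * I -> T} := [ffun q : 'I_j * I => row Z q.1 q.2].
rewrite -(@card_in_imset _ _ c).
  apply/subset_leq_card/subsetP => _ /imsetP[Z + ->].
  rewrite !inE => /andP[/eqP Zj]; apply: leq_trans; apply/subset_leq_card.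
  apply/subsetP => _ /imsetP[[i x] _ ->]; rewrite ffunE /=.
  apply/bigcupP; exists (row Z i); last exact: imset_f.
  by rewrite -mem_enum mem_nth // -cardE Zj.
have sub (Z Z' : {set copy I T}) : #|Z| = j -> #|Z'| = j -> c Z = c Z' -> Z \subset Z'.
  move=> Zj Z'j cZ; apply/subsetP => f fZ.
  have fi : index f (enum Z) < j by rewrite -Zj cardE index_mem mem_enum.
  suff -> : f = row Z' (index f (enum Z)).
    by rewrite -mem_enum mem_nth // -cardE Z'j.
  apply: copy_eq => x; have /ffunP/(_ (Ordinal fi, x)) := cZ.
  by rewrite !ffunE /= => <-; rewrite /row nth_index // mem_enum.
move=> Z Z'; rewrite !inE => /andP[/eqP Zj _] /andP[/eqP Z'j _] cZ.
by apply/eqP; rewrite eqEsubset !sub.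
Qed.

End SmallUnions.

(** * A criterion for union-freeness *)

Section Criterion.
Variables (T : finType) (Y : eqType) (t k : nat) (H : {set {set T}}).
Variables (gadget : {set T} -> Y) (support : Y -> {set T}) (centre : {set T} -> T).
Hypotheses (t2 : 2 <= t) (k1 : 1 <= k).
Hypothesis H_card : forall a, a \in H -> #|a| = t * k.
Hypothesis H_support : forall a, a \in H -> a \subset support (gadget a).
Hypothesis H_centre : forall a, a \in H -> centre a \in a.
Hypothesis H_private : forall a b, a \in H -> b \in H -> a != b ->
  gadget a = gadget b -> centre a \notin b.
Hypothesis H_far : forall a b, a \in H -> b \in H -> gadget a != gadget b ->
  #|b :&: support (gadget a)| < k.
Hypothesis H_sparse : forall Z : {set {set T}}, Z \subset H -> #|Z| <= (2 * t).+2 ->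
  #|Z| * (t * k) <= #|cover Z| + #|Z|.-1 * k.

Lemma cover_card (Z : {set {set T}}) : Z \subset H -> #|cover Z| <= #|Z| * (t * k).
Proof.
move=> /subsetP ZH; apply: leq_trans (leq_card_cover Z) _.
by rewrite -sum_nat_const leq_sum // => a /ZH/H_card ->.
Qed.

Lemma meet_le a b : a \in H -> b \in H -> a != b -> #|a :&: b| <= k.
Proof.
move=> aH bH ab; have := @H_sparse [set a; b].
have -> : cover [set a; b] = a :|: b by rewrite /cover big_setU1 ?inE //= big_set1.
rewrite subUset !sub1set aH bH cards2 ab => /(_ isT isT).
have := cardsUI a b; rewrite (H_card aH) (H_card bH) /=; set p := t * k; lia.
Qed.

(** No other edge of the same gadget contains the centre of [a], so an edge through this centre
    comes from another gadget. *)
Lemma far_meet a b : a \in H -> b \in H -> a != b -> centre a \in b -> #|b :&: support (gadget a)| < k.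
Proof.
move=> aH bH ab xb; apply: H_far => //; apply/eqP => E.
by have := H_private aH bH ab E; rewrite xb.
Qed.

(** Some edge of [Z] passes through the centre of [a] and meets [a] in fewer than k points, and
    every other edge of [Z] meets [a] in at most k. Hence t edges cover fewer than tk points of
    [a]. *)
Lemma cover_free a (Z : {set {set T}}) : a \in H -> Z \subset H -> a \notin Z ->
  a \subset cover Z -> t < #|Z|.
Proof.
move=> aH /subsetP ZH aZ aC; rewrite ltnNge; apply/negP => Zt.
have /bigcupP[c cZ xc] : centre a \in cover Z by apply: (subsetP aC); apply: H_centre.
have ne b : b \in Z -> a != b by move=> bZ; apply: contraNneq aZ => ->.
have ck : #|a :&: c| < k.
  apply: leq_ltn_trans (far_meet aH (ZH _ cZ) (ne _ cZ) xc).
  by rewrite setIC subset_leq_card // setIS // H_support.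
have le : #|a| <= \sum_(b in Z) #|a :&: b|.
  have {1}-> : a = \bigcup_(b in Z) (a :&: b).
    apply/setP => y; apply/idP/bigcupP => [ya|[b _ /setIP[]//]].
    by have /bigcupP[b bZ yb] := subsetP aC _ ya; exists b; rewrite // inE ya.
  exact: card_bigcup_le.
rewrite (bigD1 c) //= H_card // in le.
have le2 : \sum_(b in Z | b != c) #|a :&: b| <= (#|Z|.-1) * k.
  have -> : #|Z|.-1 = #|Z :\ c| by rewrite (cardsD1 c Z) cZ.
  rewrite -sum_nat_const big_mkcond [X in _ <= X]big_mkcond /=; apply: leq_sum => b _.
  rewrite in_setD1 andbC; case: ifP => // /andP[_ bZ].
  exact: meet_le (ZH _ bZ) (ne _ bZ).
have : 0 < #|Z| by apply/card_gt0P; exists c.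
case: #|Z| Zt le2 => // z /= zt le2 _; have := leq_mul zt (leqnn k).
rewrite mulSn; lia.
Qed.

Lemma big_of_notsub (A B : {set {set T}}) : A \subset H -> B \subset H ->
  #|B| <= t.+1 -> cover A = cover B -> ~~ (A \subset B) -> #|B| = t.+1.
Proof.
move=> AH BH Bt AB /subsetPn[a aA aB]; apply/eqP; rewrite eqn_leq Bt.
apply: (cover_free (subsetP AH _ aA) BH aB); rewrite -AB.
exact: bigcup_sup.
Qed.

Lemma cover_setU (Z Z' : {set {set T}}) : cover (Z :|: Z') = cover Z :|: cover Z'.
Proof. exact: bigcup_setU. Qed.

Lemma cover1 (a : {set T}) : cover [set a] = a.
Proof. by rewrite /cover big_set1. Qed.

(* Let u = |A \ B| = |B \ A|.  Sparsity of A u B gives (u - 1)(t - 1) <= 1, so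
   u = 1, or t = u = 2; the latter and t > 2 are excluded by counting.  For
   u = 1, t = 2 everything is tight: the edges a, b of A \ B and B \ A meet in k
   points, so lie in one gadget, and the common edge through the centre of a lies
   outside of it; then the other common edge meets a u b in too many points. *)
Lemma sparse_union_free : union_free t.+1 H.
Proof.
apply/forallP => A; apply/forallP => B; apply/implyP => /and5P[AH BH At Bt neAB].
apply/eqP => AB.
wlog nAB : A B AH BH At Bt neAB AB / ~~ (A \subset B).
  move=> WL; have : ~~ (A \subset B) || ~~ (B \subset A).
    by rewrite -negb_and -eqEsubset.
  by case/orP => n; [apply: (WL A B) | apply: (WL B A) => //; rewrite eq_sym].
have B1 := big_of_notsub AH BH Bt AB nAB.
have nBA : ~~ (B \subset A).
  apply: contraNN nAB => sub; have : B == A by rewrite eqEcard sub B1.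
  by move=> /eqP ->.
have A1 := big_of_notsub BH AH At (esym AB) nBA.
pose D := A :&: B; pose A' := A :\: B; pose B' := B :\: A.
have AD : A = A' :|: D by rewrite setUC setID.
have BD : B = B' :|: D by rewrite setUC /D setIC setID.
have [u uA uB] : exists2 u, #|A'| = u & #|B'| = u.
  exists #|A'| => //; have := cardsID B A; have := cardsID A B.
  rewrite -/A' -/B' -/D setIC -/D A1 B1; lia.
have uD : u + #|D| = t.+1 by rewrite -A1 -(cardsID B A) -/A' uA addnC.
have u0 : 0 < u by rewrite -uA card_gt0 setD_eq0.
have UH : A :|: B \subset H by rewrite subUset AH.
have cU : #|A :|: B| = t.+1 + u.
  have := cardsUI A B; rewrite -/D A1 B1; lia.
have covU : cover (A :|: B) = cover A by rewrite cover_setU -AB setUid.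
have S0 : (t.+1 + u) * (t * k) <= #|cover A| + (t + u) * k.
  have := H_sparse UH; rewrite cU covU addSn /=; apply; lia.
have DH : D \subset H by apply: subset_trans AH; apply: subsetIl.
have A'H : A' \subset H by apply: subset_trans AH; apply: subsetDl.
have B'H : B' \subset H by apply: subset_trans BH; apply: subsetDl.
have covA : cover A = cover A' :|: cover D by rewrite -cover_setU -AD.
have covB : cover A = cover B' :|: cover D by rewrite AB -cover_setU -BD.
have cAA := cover_card A'H; have cBB := cover_card B'H; have cDD := cover_card DH.
rewrite uA in cAA; rewrite uB in cBB.
have cA := cover_card AH; rewrite A1 in cA.
have disAB : [disjoint A' & B'].
  rewrite -setI_eq0; apply/eqP/setP => x; rewrite !inE.
  by case: (x \in A); rewrite ?andbF.
have [u2|u1] := leqP 2 u.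
  have tu : u * t <= t + u.
    rewrite -(leq_pmul2r k1); move: S0 cA; clear; nia.
  have [tt uu] : t = 2 /\ u = 2 by move: tu t2 u2; clear; nia.
  have eD : #|D| = 1 by move: uD; rewrite tt uu; clear; lia.
  have caD := cardsUI (cover A') (cover D); rewrite -covA in caD.
  have cbD := cardsUI (cover B') (cover D); rewrite -covB in cbD.
  have sub : cover A' :|: cover B' \subset cover A :\: cover D.
    have dis Z : #|cover Z :&: cover D| = 0 -> cover A = cover Z :|: cover D ->
        cover Z \subset cover A :\: cover D.
      move=> /eqP; rewrite cards_eq0 => /eqP/setP Z0 ->; apply/subsetP => x xZ.
      by have := Z0 x; rewrite !inE xZ /= => ->.
    have zA : #|cover A' :&: cover D| = 0.
      by move: cAA cDD S0 caD; rewrite eD tt uu; clear; lia.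
    have zB : #|cover B' :&: cover D| = 0.
      by move: cBB cDD S0 cbD; rewrite eD tt uu; clear; lia.
    by rewrite subUset !dis.
  have := subset_leq_card sub; rewrite cardsD (setIidPr _); last by rewrite covA subsetUr.
  (* By sparsity these four edges cover at least 5k points, but [cover A] has at most 6k points and
     2k of them belong to the single common edge, which leaves 4k. *)
  have := H_sparse (Z := A' :|: B'); rewrite cover_setU subUset A'H B'H.
  have -> : #|A' :|: B'| = 4.
    have := cardsUI A' B'; move: disAB; rewrite -setI_eq0 => /eqP ->.
    by rewrite cards0 uA uB uu addn0 => ->.
  move=> /(_ isT); rewrite tt => /(_ isT).
  by move: S0 cDD k1 caD cAA; rewrite eD tt uu; clear; lia.
have uu : u = 1 by apply/eqP; rewrite eqn_leq u0 andbT.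
have /cards1P[a A'a] : #|A'| == 1 by rewrite uA uu.
have /cards1P[b B'b] : #|B'| == 1 by rewrite uB uu.
have aH : a \in H by rewrite -sub1set -A'a.
have bH : b \in H by rewrite -sub1set -B'b.
have ab : a != b.
  by apply/eqP => E; have := disjointFr disAB (x := a); rewrite A'a B'b E !inE eqxx => /(_ isT).
have cD : #|D| = t by move: uD; rewrite uu add1n => -[].
rewrite A'a cover1 in covA; rewrite B'b cover1 in covB.
have sub : cover A \subset cover D :|: (a :&: b).
  apply/subsetP => x xA; rewrite in_setU in_setI.
  have := xA; rewrite covA in_setU; have := xA; rewrite covB in_setU.
  by case: (x \in cover D); rewrite ?orbT ?orbF // => -> ->.
have sub1 := subset_leq_card sub.
have mab := meet_le aH bH ab.
have cI := cardsUI (cover D) (a :&: b).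
rewrite cD in cDD.
(* By [sub] the union has at most t(tk) + k points, while [S0] asks for (t + 2)tk - (t + 1)k;
   together these give 2t <= t + 2. *)
have tt : t = 2.
  apply/eqP; rewrite eqn_leq t2 andbT -(leq_pmul2r k1).
  by move: S0 sub1 mab cI cDD; rewrite uu; clear; nia.
have cab : #|a :&: b| = k.
  by move: S0 sub1 mab cI cDD; rewrite uu tt; clear; lia.
have cdis : #|cover D :&: (a :&: b)| = 0.
  by move: S0 sub1 mab cI cDD; rewrite uu tt; clear; lia.
have gab : gadget a = gadget b.
  apply/eqP; apply: contraTT isT => gab; have := H_far aH bH gab.
  rewrite -[X in _ < X]cab ltnNge subset_leq_card //.
  by rewrite setIC setIS // H_support.
have xa := H_centre aH; have xb := H_private aH bH ab gab.
have /bigcupP[c1 c1D xc1] : centre a \in cover D.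
  have : centre a \in cover A by rewrite covA inE xa.
  by rewrite covB inE (negPf xb).
have ne c : c \in D -> a != c /\ b != c.
  move=> cInD; have := cInD; rewrite inE => /andP[cA' cB'].
  split; apply/eqP => E.
    by have := disjointFr disAB (x := a); have : a \in A' by [rewrite A'a inE]; rewrite /A' inE E cB'.
  by have : b \in B' by [rewrite B'b inE]; rewrite /B' inE E cA'.
have c1H := subsetP DH _ c1D.
have far1 := far_meet aH c1H (ne _ c1D).1 xc1.
have /cards1P[c2 Dc2] : #|D :\ c1| == 1.
  by have := cardsD1 c1 D; rewrite c1D cD tt /= add1n => -[<-].
have c2D : c2 \in D by have : c2 \in D :\ c1 by [rewrite Dc2 inE]; rewrite inE => /andP[].
have c2H := subsetP DH _ c2D.
have [ac2 bc2] := ne _ c2D.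
have covD : cover D = c1 :|: c2.
  by rewrite -(setD1K c1D) Dc2 cover_setU !cover1.
have supp : a :|: b \subset support (gadget a).
  by rewrite subUset H_support // gab H_support.
have c1ab : #|c1 :&: (a :|: b)| < k.
  by apply: leq_ltn_trans far1; rewrite subset_leq_card // setIS.
have cUab := cardsUI a b; rewrite cab (H_card aH) (H_card bH) in cUab.
have sub3 : (a :|: b) :\: (a :&: b) \subset (c1 :&: (a :|: b)) :|: (c2 :&: (a :|: b)).
  apply/subsetP => x /setDP[xU xI]; rewrite -setIUl inE xU andbT -covD.
  have xA : x \in cover A.
    by case/setUP: xU => [xa'|xb']; [rewrite covA inE xa' | rewrite covB inE xb'].
  have := subsetP sub _ xA; by rewrite inE (negPf xI) orbF.
have := leq_trans (subset_leq_card sub3) (leq_card_setU _ _).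
rewrite cardsD (setIidPr _); last first.
  by apply: subset_trans (subsetUl _ _); apply: subsetIl.
rewrite cab => c2big.
(* The symmetric difference of [a] and [b] has 2k points, of which [c1] contains fewer than k, so
   [c2] meets the 3k points of [a :|: b] in more than k. Then these three edges cover fewer than the
   4k points that sparsity demands. *)
have := H_sparse (Z := [set a; b; c2]).
rewrite !subUset !sub1set aH bH c2H /=.
have -> : #|[set a; b; c2]| = 3.
  by rewrite setUC cardsU1 !inE negb_or eq_sym ac2 eq_sym bc2 cards2 ab.
have -> : cover [set a; b; c2] = (a :|: b) :|: c2 by rewrite !cover_setU !cover1.
have := cardsUI (a :|: b) c2; rewrite setIC (H_card c2H).
rewrite tt => cU3 /(_ isT isT).
by move: cU3 cUab c2big c1ab k1; rewrite tt; clear; lia.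
Qed.

End Criterion.

(** * The upper bound *)

Section Blocks.
Variables (t k : nat) (S : finType).
Hypotheses (t0 : 0 < t) (k0 : 0 < k) (S_card : #|S| = t * k).

Definition block (i : 'I_t) : {set 'I_t * 'I_k} := [set p | p.1 == i].

Lemma card_block i : #|block i| = k.
Proof.
have -> : block i = setX [set i] [set: 'I_k].
  by apply/setP => -[a b]; rewrite !inE andbT.
by rewrite cardsX cards1 cardsT card_ord mul1n.
Qed.

(** As [S] has tk points, a copy of the t by k grid is a bijection, that is, an ordered partition of
    [S] into the images of the rows. A given k-set is the image of a given row for one bijection in
    C(tk, k), so t |O| >= C(tk, k) = t C(tk-1, k-1). *)
Lemma hit_blocks (O : {set {set S}}) : (forall W, W \in O -> #|W| = k) ->
  (forall f : copy ('I_t * 'I_k)%type S, exists i, f @: block i \in O) ->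
  'C((t * k).-1, k.-1) <= #|O|.
Proof.
move=> Ok hit.
have card_I : #|{: 'I_t * 'I_k}| = t * k by rewrite card_prod !card_ord.
have tk0 : 0 < t * k by rewrite muln_gt0 t0.
have binE : 'C(t * k, k) = t * 'C((t * k).-1, k.-1).
  apply/eqP; rewrite -(eqn_pmul2l k0) mulnA [k * t]mulnC.
  by rewrite -{1 2}(prednK k0) mul_bin_diag prednK // prednK.
have count : #|{: copy ('I_t * 'I_k)%type S}| <= \sum_(i : 'I_t) \sum_(W in O) #|copies_onto [set block i] W|.
  rewrite -sum1_card.
  apply: (@leq_trans (\sum_(f : copy ('I_t * 'I_k)%type S) \sum_(i : 'I_t) \sum_(W in O) (f \in copies_onto [set block i] W))).
    apply: leq_sum => f _; have [i fi] := hit f.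
    rewrite (bigD1 i) //= (bigD1 (copy_fun f @: block i)) //= inE imset_f ?inE //.
  rewrite exchange_big leq_sum // => i _; rewrite exchange_big leq_sum // => W _.
  by rewrite -sum1_card [X in _ <= X]big_mkcond leq_sum // => f _; case: (_ \in _).
have onto i (W : {set S}) : W \in O -> #|copies_onto [set block i] W| * 'C(t * k, k) = (t * k)`!.
  move=> /Ok Wk; rewrite -{1}S_card (card_copies_onto _ Wk).
    by rewrite cards1 mul1n S_card card_I ffactnn.
  by move=> e; rewrite inE => /eqP ->; exact: card_block.
have := leq_mul count (leqnn 'C(t * k, k)).
rewrite card_copy card_I S_card ffactnn big_distrl /=.
rewrite (eq_bigr (fun=> #|O| * (t * k)`!)); last first.
  move=> i _; rewrite big_distrl /= (eq_bigr (fun=> (t * k)`!)) ?sum_nat_const //.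
  by move=> W WO; rewrite onto.
rewrite sum_nat_const card_ord binE mulnA [X in _ <= X -> _]mulnC -[X in _ <= X -> _]mulnA.
by rewrite [X in _ <= X -> _]mulnC leq_pmul2l ?muln_gt0 ?fact_gt0 ?t0.
Qed.

End Blocks.

Section UpperBound.
Variables (t k : nat) (T : finType) (H : {set {set T}}).
Hypotheses (t0 : 0 < t) (k0 : 0 < k).
Hypotheses (Hr : Defs.rgraph (t * k) H) (HU : union_free t.+1 H).

Definition own (A : {set T}) : {set {set T}} :=
  [set W : {set T} | [&& #|W| == k, W \subset A &
    [forall B in H, (W \subset B) ==> (B == A)]]].

Lemma own_ge A : A \in H -> 'C((t * k).-1, k.-1) <= #|own A|.
Proof.
move=> AH; pose S : finType := {x | x \in A}.
have S_card : #|S| = t * k by rewrite card_sig; apply/eqP; have /forall_inP := Hr; apply.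
pose O := [set W : {set S} | [set val x | x in W] \in own A].
have O_own : #|O| <= #|own A|.
  rewrite -(card_imset O (imset_inj val_inj)); apply/subset_leq_card/subsetP.
  by move=> _ /imsetP[W + ->]; rewrite inE.
apply: leq_trans O_own; apply: (hit_blocks t0 k0 S_card) => [W|f].
  by rewrite !inE => /and3P[/eqP <- _ _]; rewrite card_imset //; exact: val_inj.
(* Otherwise every block lies in an edge other than [A], and the family [BB] of these edges covers
   [A]. *)
apply/existsP; apply: contraT => /existsPn nohit.
have block_other (i : 'I_t) : exists B, [&& B \in H, B != A &
    [set val x | x in f @: block k i] \subset B].
  have := nohit i; rewrite !inE card_imset; last exact: val_inj.
  rewrite card_copy_im card_block eqxx /= negb_and => /orP[/subsetPn[x /imsetP[y _ ->]]|].
    by rewrite (valP y).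
  by case/forall_inPn => B BH; rewrite negb_imply => /andP[fB BA]; exists B; rewrite BH BA.
pose other i := xchoose (block_other i).
have otherP i : [&& other i \in H, other i != A &
    [set val x | x in f @: block k i] \subset other i] := xchooseP (block_other i).
pose BB := [set other i | i : 'I_t].
have BBt : #|BB| <= t by rewrite -[X in _ <= X]card_ord leq_imset_card.
have ABB : A \notin BB.
  by apply/imsetP => -[i _ E]; have /and3P[_ + _] := otherP i; rewrite -E eqxx.
have BBH : BB \subset H by apply/subsetP => _ /imsetP[i _ ->]; case/and3P: (otherP i).
have AsubBB : A \subset cover BB.
  apply/subsetP => x xA.
  have [p fp] : exists p, Sub x xA = f p.
    have : f @: [set: 'I_t * 'I_k] == [set: S].
      by rewrite eqEcard subsetT card_copy_im !cardsT S_card card_prod !card_ord /=.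
    by move=> /eqP/setP/(_ (Sub x xA)); rewrite in_setT => /imsetP[p _ E]; exists p.
  apply/bigcupP; exists (other p.1); first exact: imset_f.
  have /and3P[_ _ /subsetP] := otherP p.1; apply.
  apply/imsetP; exists (Sub x xA) => //; rewrite fp imset_f // inE //.
(* [BB] has at most t edges, [A |: BB] at most t + 1, and both have the same union. *)
have /forallP/(_ BB)/forallP/(_ (A |: BB))/implyP := HU.
rewrite BBH subUset sub1set AH BBH cardsU1 ABB add1n ltnS BBt (leq_trans BBt) //=.
have -> : BB != A |: BB by apply: contraNneq ABB => ->; rewrite setU11.
move=> /(_ isT) /negP[]; apply/eqP; rewrite /cover big_setU1 //=; apply/esym/setUidPr.
exact: AsubBB.
Qed.

Lemma card_union_free_le : #|H| * 'C((t * k).-1, k.-1) <= 'C(#|T|, k).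
Proof.
rewrite -sum_nat_const -(card_draws T k) -sum1dep_card.
apply: (@leq_trans (\sum_(A in H) \sum_(W : {set T} | #|W| == k) (W \in own A))).
  apply: leq_sum => A AH; apply: leq_trans (own_ge AH) _.
  rewrite -sum1_card big_mkcond [X in _ <= X]big_mkcond; apply: leq_sum => W _.
  by rewrite inE; case: (#|W| == k) => //=; case: (_ && _).
rewrite exchange_big /=; apply: leq_sum => W Wk.
have [E|[A AH WA]] : \sum_(A in H) (W \in own A) = 0 \/ exists2 A, A \in H & W \in own A.
  - have [/exists_inP|/exists_inPn none] := boolP [exists A in H, W \in own A]; first by right.
    by left; apply: big1 => A AH; rewrite (negPf (none _ AH)).
- by rewrite E.
rewrite (bigD1 A) //= WA big1 // => B /andP[BH BA]; apply/eqP; rewrite eqb0.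
apply: contraNN BA; rewrite inE => /and3P[_ WB _].
by move: WA; rewrite inE => /and3P[_ _ /forall_inP/(_ _ BH)/implyP]; apply.
Qed.

End UpperBound.

Lemma U_le (t k n : nat) : 0 < t -> 0 < k ->
  U t.+1 n (t * k) * 'C((t * k).-1, k.-1) <= 'C(n, k).
Proof.
move=> t0 k0; rewrite -leq_divRL; last first.
  rewrite bin_gt0; have : 0 < t * k by rewrite muln_gt0 t0.
  have := leq_mul t0 (leqnn k); lia.
apply/bigmax_leqP => H /andP[Hr HU]; rewrite leq_divRL.
  by have := card_union_free_le t0 k0 Hr HU; rewrite card_ord.
rewrite bin_gt0; have := leq_mul t0 (leqnn k); lia.
Qed.

(** * Pendant vertices and placed gadgets *)

Definition kshadow (I : finType) (k : nat) (F : {set {set I}}) : {set {set I}} :=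
  [set e : {set I} | (#|e| == k) && [exists a in F, e \subset a]].

Section Pendant.
Variables (P : finType) (r : nat) (B : {set {set P}}).
Hypothesis B_card : forall e, e \in B -> #|e| = r.

(** The private vertex of [e] is [e] itself, tagged by [inr], so that distinct edges receive
    distinct private vertices. *)
Definition pendant (e : {set P}) : {set P + {set P}} := inr e |: inl @: e.

(** The default [inr set0] is reached only on sets without a private vertex, never on a pendant
    edge. *)
Definition tip (a : {set P + {set P}}) : P + {set P} :=
  odflt (inr set0) [pick y in a | if y is inr _ then true else false].

Lemma in_pendantl x e : (inl x \in pendant e) = (x \in e).
Proof. by rewrite !inE /=; apply/imsetP/idP => [[y ye [->]]|xe] //; exists x. Qed.

Lemma in_pendantr e e' : (inr e' \in pendant e) = (e' == e).
Proof.
rewrite !inE; apply/orP/idP => [[/eqP[->]|/imsetP[y _ //]]|/eqP->]; first by [].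
by left.
Qed.

Lemma tip_pendant e : tip (pendant e) = inr e.
Proof.
rewrite /tip; case: pickP => [[x|e'] /andP[]|/(_ (inr e))] //=.
  by rewrite in_pendantr => /eqP ->.
by rewrite in_pendantr eqxx.
Qed.

Lemma inl_inj : injective (@inl P {set P}). Proof. by move=> x y []. Qed.

Lemma inr_inj : injective (@inr P {set P}). Proof. by move=> x y []. Qed.

Lemma pendant_inj : injective pendant.
Proof. by move=> e e' E; have := tip_pendant e; rewrite E tip_pendant => -[]. Qed.

Lemma card_pendant e : #|pendant e| = #|e|.+1.
Proof.
rewrite cardsU1 card_imset ?add1n; last exact: inl_inj.
by case: imsetP => // -[].
Qed.

Lemma cover_pendant (Z : {set {set P}}) :
  #|cover (pendant @: Z)| = (#|cover Z| + #|Z|)%N.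
Proof.
have -> : cover (pendant @: Z) = inl @: cover Z :|: inr @: Z.
  apply/setP => y; apply/bigcupP/setUP => [[_ /imsetP[e eZ ->]]|].
    case: y => [x|e']; rewrite ?in_pendantl ?in_pendantr => ye.
      by left; apply: imset_f; apply/bigcupP; exists e.
    by right; rewrite (eqP ye) imset_f.
  case=> /imsetP[x + ->]; last by move=> xZ; exists (pendant x); rewrite ?imset_f ?in_pendantr.
  by case/bigcupP => e eZ xe; exists (pendant e); rewrite ?imset_f ?in_pendantl.
rewrite -(card_imset (cover Z) inl_inj) -(card_imset Z inr_inj) -cardsUI.
rewrite (_ : _ :&: _ = set0) ?cards0 ?addn0 //.
by apply/setP => y; rewrite !inE; apply/negP => /andP[/imsetP[? _ ->] /imsetP[? _ ]].
Qed.

(** A k-set of the shadow either contains the private vertex of an edge [e], and is then given by k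
    - 1 points of [e], or lies in the old vertices. The second kind becomes negligible once [B] is
    much larger than C(|P|, k). *)
Lemma kshadow_pendant k : 0 < k ->
  #|kshadow k (pendant @: B)| <= #|B| * 'C(r, k.-1) + 'C(#|P|, k).
Proof.
move=> k0.
pose F1 := \bigcup_(e in B) [set inr e |: inl @: (d : {set P}) | d : {set P} in [set d : {set P} | d \subset e & #|d| == k.-1]].
pose F2 : {set {set P + {set P}}} := [set inl @: (d : {set P}) | d : {set P} in [set d : {set P} | #|d| == k]].
have sub : kshadow k (pendant @: B) \subset F1 :|: F2.
  apply/subsetP => c; rewrite inE => /andP[/eqP ck /exists_inP[_ /imsetP[e eB ->] ce]].
  pose d := [set x : P | inl x \in c].
  have de : d \subset e.
    by apply/subsetP => x; rewrite inE => /(subsetP ce); rewrite in_pendantl.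
  have [ec|ec] := boolP (inr e \in c).
    have cE : c = inr e |: inl @: d.
      apply/setP => -[x|e']; rewrite !inE /=.
        by apply/idP/imsetP => [xc|[y + [->]]]; [exists x; rewrite ?inE | rewrite inE].
      apply/idP/orP => [e'c|[/eqP[->]|/imsetP[//]]] //.
      by left; have := subsetP ce _ e'c; rewrite in_pendantr => /eqP ->.
    apply/setUP; left; apply/bigcupP; exists e => //; apply/imsetP; exists d => //.
    rewrite inE de /=; move: ck; rewrite cE cardsU1 card_imset; last exact: inl_inj.
    by case: imsetP => [[]//|_] /= <-.
  have cE : c = inl @: d.
    apply/setP => -[x|e'].
      by apply/idP/imsetP => [xc|[y + [->]]]; [exists x; rewrite ?inE | rewrite inE].
    apply/idP/imsetP => [e'c|[//]].
    by have := subsetP ce _ e'c; rewrite in_pendantr => /eqP E; rewrite -E e'c in ec.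
  apply/setUP; right; apply/imsetP; exists d => //.
  by rewrite inE -ck cE card_imset //; exact: inl_inj.
apply: leq_trans (subset_leq_card sub) _; apply: leq_trans (leq_card_setU _ _) _.
apply: leq_add; last first.
  by apply: leq_trans (leq_imset_card _ _) _; rewrite card_draws.
apply: leq_trans (card_bigcup_le (fun e => e \in B) _) _.
rewrite -sum_nat_const; apply: leq_sum => e eB.
by apply: leq_trans (leq_imset_card _ _) _; rewrite cards_draws B_card.
Qed.

End Pendant.

(* A point lying in d > 0 of the sets has excess d - 1, which decreases when the
   sets shrink. *)
Lemma excess_le (C T : finType) (S : {set C}) (E V : C -> {set T}) :
  (forall f, f \in S -> E f \subset V f) ->
  \sum_(f in S) #|E f| + #|\bigcup_(f in S) V f| <=
  \sum_(f in S) #|V f| + #|\bigcup_(f in S) E f|.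
Proof.
move=> EV.
have cE (A : {set T}) : #|A| = \sum_x (x \in A).
  by rewrite -sum1_card big_mkcond; apply: eq_bigr => x _; case: (x \in A).
under eq_bigr do rewrite cE.
under [X in _ <= X + _]eq_bigr do rewrite cE.
rewrite exchange_big [X in _ <= X + _]exchange_big /= !cE -!big_split /=.
apply: leq_sum => x _; set m := \sum_(f in S) (x \in V f).
have [/bigcupP[f fS xf]|nE] := boolP (x \in \bigcup_(f in S) E f).
  apply: leq_add; last by case: (x \in _).
  by apply: leq_sum => f' f'S; have /subsetP/(_ x) := EV _ f'S; case: (x \in E f') => // ->.
rewrite big1 => [|f fS]; last first.
  by apply/eqP; rewrite eqb0; apply: contraNN nE => xf; apply/bigcupP; exists f.
rewrite add0n addn0; case: bigcupP => // -[f fS xf].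
by rewrite /m (bigD1 f) //= xf.
Qed.

Lemma subset_of_card (T : finType) (A : {set T}) (k : nat) : k <= #|A| ->
  exists2 W : {set T}, W \subset A & #|W| = k.
Proof.
rewrite -bin_gt0 -cards_draws => /card_gt0P[W]; rewrite inE => /andP[WA /eqP Wk].
by exists W.
Qed.

Lemma copy_subset (I T : finType) (f : copy I T) (A : {set I}) (W : {set T}) :
  W \subset f @: A -> exists2 e : {set I}, e \subset A & W = f @: e.
Proof.
move=> /subsetP WA; exists [set y in A | f y \in W].
  by apply/subsetP => y; rewrite inE => /andP[].
apply/setP => z; apply/idP/imsetP => [zW|[y + ->]]; last by rewrite inE => /andP[].
by have /imsetP[y yA zy] := WA _ zW; exists y; rewrite ?inE ?yA -?zy.
Qed.

(** * Edges of packed gadgets *)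

Section Assemble.
Variables (t k : nat) (I T : finType) (F : {set {set I}}) (x : {set I} -> I).
Variables (X : {set {set T}}) (M : {set copy I T}).
Hypotheses (t2 : 2 <= t) (k1 : 1 <= k).
Let J := (2 * t).+2.
Hypothesis F_card : forall a, a \in F -> #|a| = t * k.
Hypothesis x_in : forall a, a \in F -> x a \in a.
Hypothesis x_private : forall a b, a \in F -> b \in F -> a != b -> x a \notin b.
Hypothesis F_sparse : forall Z : {set {set I}}, Z \subset F -> #|Z| <= J ->
  #|Z| * (t * k) <= #|cover Z| + #|Z|.-1 * k.
Hypothesis M_X : forall f : copy I T, f \in M -> forall e : {set I}, #|e| = k ->
  (f @: e \in X) = (e \notin kshadow k F).
Hypothesis M_disj : forall f f' : copy I T, f \in M -> f' \in M -> f != f' ->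
  forall e e' : {set I}, e \in kshadow k F -> e' \in kshadow k F -> f @: e != f' @: e'.
Hypothesis M_sparse : forall Z : {set copy I T}, Z \subset M -> #|Z| <= J ->
  #|Z| * #|I| <= #|span Z| + #|Z|.-1 * k.

Definition place (p : copy I T * {set I}) : {set T} := copy_fun p.1 @: p.2.

Definition placed : {set {set T}} := place @: setX M F.

(** Suppose a k-set lies in the edge of [f'] and in the vertex set of [f]. Being in the shadow of
    [f'] it avoids [X], hence it is also in the shadow of [f], because non-shadow sets of [f] lie in
    [X]. This contradicts the disjointness of the two shadows. *)
Lemma far_place (f f' : copy I T) a : f \in M -> f' \in M -> f != f' -> a \in F ->
  #|f' @: a :&: f @: [set: I]| < k.
Proof.
move=> fM f'M ff' aF; rewrite ltnNge; apply/negP => /subset_of_card[W WI Wk].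
have [e' e'a W'] : exists2 e' : {set I}, e' \subset a & W = f' @: e'.
  by apply: copy_subset; apply: subset_trans WI (subsetIl _ _).
have [e _ We] : exists2 e : {set I}, e \subset [set: I] & W = f @: e.
  by apply: copy_subset; apply: subset_trans WI (subsetIr _ _).
have ek : #|e| = k by rewrite -(card_copy_im f) -We.
have e'k : #|e'| = k by rewrite -(card_copy_im f') -W'.
have e'G : e' \in kshadow k F by rewrite inE e'k eqxx; apply/exists_inP; exists a.
have := M_X f'M e'k; rewrite e'G /= -W' We (M_X fM ek) => /negbFE eG.
by have := M_disj fM f'M ff' eG e'G; rewrite -We -W' eqxx.
Qed.

Lemma place_inj : {in setX M F &, injective place}.
Proof.
move=> [f a] [f' a'] /setXP[/= fM aF] /setXP[/= f'M a'F]; rewrite /place /= => E.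
have [ff'|ff'] := eqVneq f f'.
  by subst f'; congr (_, _); apply: (copy_im_inj E).
have := far_place fM f'M ff' a'F; rewrite -E (setIidPl _) ?imsetS ?subsetT //.
by rewrite card_copy_im F_card // ltnNge leq_pmull // ltnW.
Qed.

Lemma card_placed : #|placed| = #|M| * #|F|.
Proof. by rewrite /placed card_in_imset ?cardsX //; exact: place_inj. Qed.

Lemma placed_rgraph : Defs.rgraph (t * k) placed.
Proof.
apply/forall_inP => _ /imsetP[[f a] /setXP[/= fM aF] ->].
by rewrite /place /= card_copy_im F_card.
Qed.

(** The edges are grouped by the copy they lie in. Inside a copy the gadget is sparse, between
    copies the packing is sparse, and [excess_le] replaces the full vertex set of a copy by the part
    covered by its chosen edges. The terms |S| k cancel when the three inequalities are added. *)
Lemma placed_sparse (Z : {set {set T}}) : Z \subset placed -> #|Z| <= J ->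
  #|Z| * (t * k) <= #|cover Z| + #|Z|.-1 * k.
Proof.
move=> Zp ZJ; have [->|Zn0] := eqVneq Z set0; first by rewrite cards0.
pose Z' := [set p in setX M F | place p \in Z].
have Z'sub : Z' \subset setX M F by apply/subsetP => p; rewrite inE => /andP[].
have ZE : Z = place @: Z'.
  apply/setP => a; apply/idP/imsetP => [aZ|[p + ->]]; last by rewrite inE => /andP[].
  by have /imsetP[p pX ap] := subsetP Zp _ aZ; exists p; rewrite // inE pX -ap.
have cZ : #|Z| = #|Z'|.
  by rewrite ZE card_in_imset // => p q /(subsetP Z'sub) ? /(subsetP Z'sub) ?; exact: place_inj.
clearbody Z'.
pose S := [set f : copy I T | [exists a, (f, a) \in Z']].
pose Zf (f : copy I T) := [set a | (f, a) \in Z'].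
have SM : S \subset M.
  by apply/subsetP => f; rewrite inE => /existsP[a /(subsetP Z'sub)/setXP[]].
have ZfF f : Zf f \subset F.
  by apply/subsetP => a; rewrite inE => /(subsetP Z'sub)/setXP[].
have sumZ : #|Z| = \sum_(f in S) #|Zf f|.
  rewrite cZ -sum1_card.
  transitivity (\sum_(p : copy I T * {set I} | (p.1 \in S) && (p.2 \in Zf p.1)) 1).
    apply: eq_bigl => -[f a] /=; rewrite !inE; apply/idP/andP => [h|[_ //]]; split=> //.
    by apply/existsP; exists a.
  rewrite -(pair_big_dep (fun f => f \in S) (fun f a => a \in Zf f) (fun _ _ => 1)) /=.
  by apply: eq_bigr => f _; rewrite sum1_card.
have Zf0 f : f \in S -> 0 < #|Zf f|.
  by rewrite inE => /existsP[a fa]; apply/card_gt0P; exists a; rewrite inE.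
have SZ : #|S| <= #|Z| by rewrite sumZ -sum1_card leq_sum.
have ZfZ f : f \in S -> #|Zf f| <= #|Z| by move=> fS; rewrite sumZ (bigD1 f) //= leq_addr.
pose E (f : copy I T) : {set T} := f @: cover (Zf f).
have covE : cover Z = \bigcup_(f in S) E f.
  rewrite ZE; apply/setP => y; apply/bigcupP/bigcupP.
    case=> _ /imsetP[[f a] faZ ->] /imsetP[z za ->]; exists f.
      by rewrite inE; apply/existsP; exists a.
    by apply/imset_f/bigcupP; exists a; rewrite // inE.
  case=> f fS /imsetP[z /bigcupP[a + za] ->]; rewrite inE => faZ.
  by exists (place (f, a)); rewrite ?imset_f.
have ex := @excess_le _ _ S E (fun f : copy I T => f @: [set: I]) (fun f _ => imsetS _ (subsetT _)).
rewrite -covE -/(span S) in ex.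
have sumI : \sum_(f in S) #|copy_fun f @: [set: I]| = #|S| * #|I|.
  by rewrite -sum_nat_const; apply: eq_bigr => f _; rewrite card_copy_im cardsT.
rewrite sumI in ex.
have MS := M_sparse SM (leq_trans SZ ZJ).
have sumle : #|Z| * (t * k) + #|S| * k <= \sum_(f in S) #|E f| + #|Z| * k.
  rewrite sumZ !big_distrl /= -sum_nat_const -!big_split /=; apply: leq_sum => f fS.
  have := F_sparse (ZfF f) (leq_trans (ZfZ _ fS) ZJ).
  rewrite /E card_copy_im; have := Zf0 f fS; case: #|Zf f| => // i _ /=.
  by rewrite [_.+1 * k]mulSn => h; rewrite addnCA addnC leq_add2l.
have S0 : 0 < #|S|.
  have [a aZ] := set0Pn _ Zn0; move: aZ; rewrite ZE => /imsetP[[f b] fb _].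
  by apply/card_gt0P; exists f; rewrite inE; apply/existsP; exists b.
have Z0 : 0 < #|Z| by rewrite card_gt0.
move: ex MS sumle S0 Z0; case: #|S| => // s; case: #|Z| => // z; rewrite !mulSn /= -!mulSn.
move: (s.+1 * #|I|) (\sum_(f in S) _) #|span S| #|cover Z| (z.+1 * (t * k)).
clear; move=> a b c d e; lia.
Qed.

Lemma placed_union_free : union_free t.+1 placed.
Proof.
(* A pair of a copy and an edge serves as the default of [decode], so the case without pairs is
   settled first. *)
have [p0|] := set_0Vmem (setX M F).
  apply/forallP => A; apply/forallP => B; apply/implyP => /and5P[+ + _ _].
  rewrite /placed p0 imset0 !subset0 => /eqP -> /eqP ->; by rewrite eqxx.
case=> p0 p0X.
pose decode a := odflt p0 [pick p in setX M F | place p == a].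
have decodeK p : p \in setX M F -> decode (place p) = p.
  move=> pX; rewrite /decode; case: pickP => [q /andP[qX /eqP/place_inj]|/(_ p)] /=.
    exact.
  by rewrite pX eqxx.
apply: (@sparse_union_free _ _ t k placed (fun a => (decode a).1)
  (fun f : copy I T => f @: [set: I])
  (fun a => copy_fun (decode a).1 (x (decode a).2)) t2 k1).
- by move=> _ /imsetP[[f a] /setXP[/= fM aF] ->]; rewrite /place /= card_copy_im F_card.
- by move=> _ /imsetP[p pX ->]; rewrite decodeK // imsetS ?subsetT.
- move=> _ /imsetP[[f a] pX ->]; rewrite decodeK //=; apply: imset_f; apply: x_in.
  by case/setXP: pX.
- move=> _ _ /imsetP[[f a] pX ->] /imsetP[[f' a'] qX ->]; rewrite !decodeK //= => ne E.
  subst f'; move: pX qX => /setXP[/= fM aF] /setXP[/= _ a'F].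
  apply/imsetP => -[y ya' /copy_inj E]; have := x_private aF a'F.
  rewrite E ya' /=; have -> : a != a' by apply: contraNneq ne => ->.
  by move=> /(_ isT).
- move=> _ _ /imsetP[[f a] pX ->] /imsetP[[f' a'] qX ->]; rewrite !decodeK //=.
  by move: pX qX => /setXP[/= fM _] /setXP[/= f'M a'F] ne; apply: far_place.
- exact: placed_sparse.
Qed.

End Assemble.

Local Open Scope ring_scope.

(** * The nibble *)

Section Expectation.
Variables (R : realFieldType) (W : Type).

(** Only linearity, monotonicity and normalisation are recorded. No probability space is built, and
    iterated expectations such as [rounds] satisfy the same axioms. *)
Record expectation (E : (W -> R) -> R) : Prop := Expectation {
  expD : forall f g, E (fun w => f w + g w) = E f + E g;
  expZ : forall a f, E (fun w => a * f w) = a * E f;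
  exp_le : forall f g, (forall w, f w <= g w) -> E f <= E g;
  exp1 : E (fun=> 1) = 1 }.

Variables (E : (W -> R) -> R) (hE : expectation E).

Lemma exp_ext f g : f =1 g -> E f = E g.
Proof.
by move=> fg; apply/eqP; rewrite eq_le; apply/andP; split;
  apply: exp_le => // w; rewrite fg.
Qed.

Lemma exp_cst a : E (fun=> a) = a.
Proof.
by rewrite (@exp_ext _ (fun=> a * 1)) ?expZ ?exp1 ?mulr1 // => w; rewrite mulr1.
Qed.

Lemma expB f g : E (fun w => f w - g w) = E f - E g.
Proof.
rewrite (@exp_ext _ (fun w => f w + -1 * g w)); last by move=> w; rewrite mulN1r.
by rewrite expD // expZ // mulN1r.
Qed.

Lemma exp_sum (I : Type) (s : seq I) (P : pred I) (F : I -> W -> R) :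
  E (fun w => \sum_(i <- s | P i) F i w) = \sum_(i <- s | P i) E (F i).
Proof.
elim: s => [|i s IH].
  by rewrite (@exp_ext _ (fun=> 0)) ?exp_cst ?big_nil // => w; rewrite big_nil.
rewrite big_cons -IH; case: ifP => Pi.
  by rewrite -expD //; apply: exp_ext => w; rewrite big_cons Pi.
by apply: exp_ext => w; rewrite big_cons Pi.
Qed.

Lemma exp_norm f : `|E f| <= E (fun w => `|f w|).
Proof.
rewrite ler_norml -[- E _]mulN1r -expZ //; apply/andP; split; apply: exp_le => // w.
  by rewrite mulN1r lerNl -normrN ler_norm.
exact: ler_norm.
Qed.

End Expectation.

(** * Random subsets with independent points *)

Section Bernoulli.
Variables (R : realFieldType) (T : finType) (p : R).

(** The expectation of [f] at a random set that contains each point independently with probability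
    [p]. *)
Definition bern (f : {set T} -> R) : R :=
  \sum_(S : {set T}) (\prod_x (if x \in S then p else 1 - p)) * f S.

Lemma bern_total : \sum_(S : {set T}) (\prod_x (if x \in S then p else 1 - p)) = 1.
Proof.
rewrite -(@bigA_distr R 0 1 *%R +%R T (fun=> p) (fun=> 1 - p)).
by rewrite big1 // => x _; rewrite /= subrKC.
Qed.

Lemma bern_expectation : 0 <= p <= 1 -> expectation bern.
Proof.
move=> /andP[p0 p1]; split=> [f g|a f|f g fg|]; rewrite /bern.
- by rewrite -big_split; apply: eq_bigr => S _; rewrite mulrDr.
- by rewrite mulr_sumr; apply: eq_bigr => S _; rewrite mulrCA.
- apply: ler_sum => S _; apply: ler_wpM2l => //.
  by apply: prodr_ge0 => x _; case: ifP; lra.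
- by rewrite -[RHS]bern_total; apply: eq_bigr => S _; rewrite mulr1.
Qed.

(** If [f] stayed below [c] everywhere, the weighted sum of the positive gaps [c - f S] would be at
    most 0. All weights would then vanish, although their sum is 1. *)
Lemma bern_exists f c : 0 <= p <= 1 -> c <= bern f -> exists S, c <= f S.
Proof.
move=> hp cf; apply/existsP; apply: contraT => /existsPn f_lt.
have gap0 S : 0 < c - f S by rewrite subr_gt0 ltNge f_lt.
pose wt (S : {set T}) : R := \prod_x (if x \in S then p else 1 - p).
have wt0 S : 0 <= wt S by apply: prodr_ge0 => x _; case: ifP; lra.
have wt_gap0 S : 0 <= wt S * (c - f S) by rewrite mulr_ge0 // ltW.
have total0 : \sum_(S : {set T}) wt S * (c - f S) = 0.
  apply/le_anti; rewrite sumr_ge0 // andbT.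
  have hE := bern_expectation hp; rewrite -(exp_cst hE c) -subr_le0 in cf.
  by rewrite -expB in cf.
have := bern_total; rewrite big1 => [/eqP|S _]; first by rewrite eq_sym oner_eq0.
have := psumr_eq0P (fun S _ => wt_gap0 S) total0 => /(_ S isT)/eqP.
by rewrite mulf_eq0 (gt_eqF (gap0 S)) orbF => /eqP.
Qed.

Lemma bern_avoid (A B : {set T}) : [disjoint A & B] ->
  bern (fun S => ((A \subset S) && [disjoint B & S])%:R)
  = p ^+ #|A| * (1 - p) ^+ #|B|.
Proof.
move=> dAB; rewrite /bern.
(* [F] is the weight of a point inside [S] and [G] that of a point outside, replaced by 0 where the
   event forbids it; expanding the product of F + G yields the sum over [S]. *)
pose F x : R := if x \in B then 0 else p.
pose G x : R := if x \in A then 0 else 1 - p.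
have -> : p ^+ #|A| * (1 - p) ^+ #|B| = \prod_x (F x + G x).
  rewrite -!prodr_const big_mkcond /= [X in _ * X]big_mkcond /= -big_split /=.
  apply: eq_bigr => x _; rewrite /F /G.
  have := disjointFr dAB (x := x); case: (x \in A) => [->//|_].
    by rewrite mulr1 addr0.
  by case: (x \in B); rewrite ?mul1r ?mulr1 ?add0r // subrKC.
rewrite bigA_distr; apply: eq_bigr => S _.
case: (boolP (A \subset S)) => [/subsetP AS|/subsetPn[x xA xS]] /=; last first.
  by rewrite mulr0 (bigD1 x) //= (negPf xS) /G xA mul0r.
case: (boolP [disjoint B & S]) => [dBS|]; last first.
  rewrite disjoint_subset => /subsetPn[x xB]; rewrite inE negbK => xS.
  by rewrite mulr0 (bigD1 x) //= xS /F xB mul0r.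
rewrite mulr1; apply: eq_bigr => x _; rewrite /F /G; case: ifP => xS.
  by rewrite (disjointFl dBS xS).
by case: ifP => // /AS; rewrite xS.
Qed.

Lemma bern_sub (A : {set T}) : bern (fun S => (A \subset S)%:R) = p ^+ #|A|.
Proof.
have := bern_avoid (A := A) (B := set0); rewrite cards0 mulr1 => <-; last first.
  by rewrite disjoint_sym disjoints_subset sub0set.
by apply: eq_bigr => S _; rewrite disjoints_subset sub0set andbT.
Qed.

Lemma bern_disj (B : {set T}) : bern (fun S => [disjoint B & S]%:R) = (1 - p) ^+ #|B|.
Proof.
have := bern_avoid (A := set0) (B := B); rewrite cards0 mul1r => <-; last first.
  by rewrite disjoints_subset sub0set.
by apply: eq_bigr => S _; rewrite sub0set.
Qed.

End Bernoulli.

(** Bernoulli's inequality. It turns an error in the number of copies that threaten a set into an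
    error in its survival probability. *)
Lemma ler_distXn (R : realFieldType) (x : R) (m n : nat) : 0 <= x <= 1 ->
  `|x ^+ m - x ^+ n| <= (1 - x) * `|m%:R - n%:R|.
Proof.
move=> /andP[x0 x1].
wlog mn : m n / (m <= n)%N.
  move=> H; case: (leqP m n) => [|/ltnW] /H // {}H.
  by rewrite distrC [`|m%:R - _|]distrC.
rewrite -(subnKC mn) exprD natrD opprD addNKr normrN normr_nat.
have -> : x ^+ m - x ^+ m * x ^+ (n - m) = x ^+ m * (1 - x ^+ (n - m)) by ring.
have xm i : 0 <= x ^+ i <= 1 by rewrite exprn_ge0 // exprn_ile1.
have B i : 1 - x ^+ i <= (1 - x) * i%:R.
  elim: i => [|i IH]; first by rewrite expr0 subrr mulr0.
  rewrite exprS -addn1 natrD mulrDr mulr1.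
  have /andP[] := xm i; set y := x ^+ i in IH * => y0 y1.
  have : 0 <= (1 - x) * (1 - y) by rewrite mulr_ge0 ?subr_ge0.
  by lra.
have /andP[y0 y1] := xm (n - m)%N; have /andP[z0 z1] := xm m.
rewrite ger0_norm ?mulr_ge0 ?subr_ge0 //; apply: le_trans (B _).
by rewrite ler_piMl // subr_ge0.
Qed.

(** * One round of the nibble *)

Section Structure.
Variables (R : realFieldType) (V C : finType) (K : {set V}) (g b : C -> {set V}).
Variables (h m D : nat) (kappa : R).

(** The abstract packing problem: elements of [K] stand for k-sets and [c] for a copy, which covers
    the k-sets in [g c] and needs those in [b c] to be sacrificed. The size of [g c] is written
    [h.+1] since a copy at T requires [h] further live sets. *)
Record regular_system : Prop := RegularSystem {
  g_sub : forall c, g c \subset K;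
  b_sub : forall c, b c \subset K;
  gb_disj : forall c, [disjoint g c & b c];
  g_card : forall c, #|g c| = h.+1;
  b_card : forall c, #|b c| = m;
  g_deg : forall T, T \in K -> #|[set c | T \in g c]| = D;
  g_codeg : forall T T', T \in K -> T' \in K -> T != T' ->
    #|[set c | (T \in g c) && (T' \in g c :|: b c)]|%:R <= kappa * D%:R }.

Hypothesis hS : regular_system.

Definition good (X L : {set V}) : {set C} :=
  [set c | (g c \subset L) && (b c \subset X)].

Definition inside (X L A B : {set V}) : R := ((A \subset L) && (B \subset X))%:R.

Lemma inside_ge0 X L A B : 0 <= inside X L A B. Proof. exact: ler0n. Qed.

Lemma inside_le1 X L A B : inside X L A B <= 1. Proof. by rewrite /inside; case: (_ && _). Qed.

Lemma insideM X L A B A' B' :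
  inside X L A B * inside X L A' B' = inside X L (A :|: A') (B :|: B').
Proof.
rewrite /inside !subUset -natrM mulnb; congr (_%:R)%R.
by rewrite andbACA.
Qed.

Section Step.
Variables (W : Type) (E : (W -> R) -> R) (X L : W -> {set V}).
Variables (p delta e : R).
Hypothesis hE : expectation E.
Hypotheses (hp : 0 <= p <= 1) (hd : 0 <= delta <= 1) (he : 0 <= e).
Hypothesis kappa_ge0 : 0 <= kappa.

(* To be read for E a probability: any i k-sets are live and any j others lie
   in X with probability about p^i delta^j, as if all these were independent. *)
Definition quasi (i j : nat) := forall A B : {set V}, A \subset K -> B \subset K ->
  [disjoint A & B] -> #|A| = i -> #|B| = j ->
  `|E (fun w => inside (X w) (L w) A B) - p ^+ i * delta ^+ j| <= e.

Hypotheses (q10 : quasi 1 0) (qhm : quasi h.+1 m) (q2 : quasi (h + h).+1 (m + m)).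

Definition deg w T : R := #|[set c in good (X w) (L w) | T \in g c]|%:R.

Lemma degE w T :
  deg w T = \sum_(c | T \in g c) inside (X w) (L w) (g c) (b c).
Proof.
rewrite /deg -sum1_card natr_sum big_mkcond [RHS]big_mkcond /=.
apply: eq_bigr => c _; rewrite !inE /inside andbC.
by case: (T \in g c) => //=; case: (_ && _).
Qed.

Lemma deg_live w T : T \notin L w -> deg w T = 0.
Proof.
move=> TL; rewrite degE big1 // => c Tc; rewrite /inside.
case: (boolP (g c \subset L w)) => // /subsetP /(_ _ Tc); by rewrite (negPf TL).
Qed.

(** The approximate mean degree of T given that T is live, which explains the exponent [h] in place
    of [h.+1]. *)
Let mu : R := D%:R * (p ^+ h * delta ^+ m).

Lemma sumr1_card (P : pred C) : \sum_(c | P c) (1 : R) = #|[set c | P c]|%:R.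
Proof. by rewrite -sum1dep_card natr_sum. Qed.

Lemma mean_deg T : T \in K ->
  D%:R * (p ^+ h.+1 * delta ^+ m - e) <= E (fun w => deg w T).
Proof.
move=> TK.
rewrite (exp_ext hE (g := fun w => \sum_(c | T \in g c)
   inside (X w) (L w) (g c) (b c))); last by move=> w; exact: degE.
rewrite exp_sum // -(g_deg hS TK) -sumr1_card mulr_suml; apply: ler_sum => c Tc.
have := qhm (g_sub hS c) (b_sub hS c) (gb_disj hS c) (g_card hS c) (b_card hS c).
by rewrite mul1r ler_norml => /andP[]; lra.
Qed.

(* Two clean copies at T use 2h+1 live sets and 2m sets of X, all different, so
   their joint probability factors up to e; all other pairs are negligible by
   the codegree bound. *)
Definition clean c c' T := ((g c :|: b c) :&: (g c' :|: b c') \subset [set T]).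

Lemma pair_clean c c' T : T \in g c -> T \in g c' -> clean c c' T ->
  E (fun w => inside (X w) (L w) (g c) (b c) * inside (X w) (L w) (g c') (b c'))
  <= p ^+ (h + h).+1 * delta ^+ (m + m) + e.
Proof.
move=> Tc Tc' /subsetP cl.
have gb c0 x : x \in g c0 -> x \in b c0 -> False.
  by move=> xg xb; have := disjointFr (gb_disj hS c0) xg; rewrite xb.
have cl' x : (x \in g c) || (x \in b c) -> (x \in g c') || (x \in b c') -> x = T.
  by move=> xc xc'; apply/set1P/cl; rewrite !inE xc xc'.
rewrite (exp_ext hE (g := fun w => inside (X w) (L w) (g c :|: g c') (b c :|: b c')));
  last by move=> w; exact: insideM.
have := q2 (A := g c :|: g c') (B := b c :|: b c').
rewrite !subUset !(g_sub hS) !(b_sub hS) => /(_ isT isT) H.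
have /H{}H : [disjoint g c :|: g c' & b c :|: b c'].
  rewrite -setI_eq0; apply/eqP/setP => x; rewrite !inE; apply/negP => /andP[xg xb].
  have [xbc|xbc'] := orP xb.
  - case/orP: xg => [xgc|xgc']; first exact: (gb c x).
    have xT : x = T by apply: cl'; rewrite ?xbc ?xgc' ?orbT.
    by apply: (gb c x); rewrite ?xT // -xT.
  - case/orP: xg => [xgc|xgc']; last exact: (gb c' x).
    have xT : x = T by apply: cl'; rewrite ?xbc' ?xgc ?orbT.
    by apply: (gb c' x); rewrite ?xT // -xT.
have /H{}H : #|g c :|: g c'| = (h + h).+1.
  have := cardsUI (g c) (g c'); rewrite !(g_card hS).
  have -> : g c :&: g c' = [set T].
    apply/setP => x; rewrite in_setI in_set1; apply/andP/eqP => [[xc xc']|-> //].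
    by apply: cl'; rewrite ?xc ?xc'.
  rewrite cards1; lia.
have /H{}H : #|b c :|: b c'| = (m + m)%N.
  have := cardsUI (b c) (b c'); rewrite !(b_card hS).
  have -> : b c :&: b c' = set0.
    apply/setP => x; rewrite !inE; apply/negP => /andP[xc xc'].
    have xT : x = T by apply: cl'; rewrite ?xc ?xc' ?orbT.
    by apply: (gb c x); rewrite ?xT // -xT.
  by rewrite cards0 addn0.
by move: H; rewrite ler_norml => /andP[_]; lra.
Qed.

(** A copy that is not clean with respect to [c] shares with it one of the h + m sets other than T,
    and each of these costs one codegree. *)
Lemma unclean_few c T : T \in g c ->
  #|[set c' | (T \in g c') && ~~ clean c c' T]|%:R <= (h + m)%:R * (kappa * D%:R).
Proof.
move=> Tc; have TK : T \in K by have /subsetP := g_sub hS c; apply.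
pose Y := (g c :|: b c) :\ T.
have YE : #|Y| = (h + m)%N.
  have := cardsUI (g c) (b c); have -> : g c :&: b c = set0.
    by apply/eqP; rewrite setI_eq0 (gb_disj hS).
  have := cardsD1 T (g c :|: b c); rewrite inE Tc /= -/Y.
  by rewrite cards0 (g_card hS) (b_card hS); lia.
have sub : [set c' | (T \in g c') && ~~ clean c c' T] \subset
    \bigcup_(T' in Y) [set c' | (T \in g c') && (T' \in g c' :|: b c')].
  apply/subsetP => c'; rewrite inE => /andP[Tc' /subsetPn[T' /setIP[T'c T'c'] T'T]].
  apply/bigcupP; exists T'; first by rewrite in_setD1 T'c -in_set1 T'T.
  by rewrite inE Tc'.
have := subset_leq_card sub; rewrite -(ler_nat R) => /le_trans; apply.
apply: (@le_trans _ _ (\sum_(T' in Y) (kappa * D%:R))); last first.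
  by rewrite sumr_const YE mulr_natl.
have := card_bigcup_le (fun T' => T' \in Y) (fun T' => [set c' | (T \in g c') && (T' \in g c' :|: b c')]).
rewrite -(ler_nat R) natr_sum => /le_trans; apply.
apply: ler_sum => T'; rewrite /= in_setD1 eq_sym => /andP[T'T T'c].
apply: (g_codeg hS) => //.
have /subsetP := g_sub hS c; have /subsetP := b_sub hS c.
by case/setUP: T'c => T'c Hb Hg; [apply: Hg | apply: Hb].
Qed.

Lemma second_moment T : T \in K ->
  E (fun w => deg w T ^+ 2) <=
  D%:R ^+ 2 * (p ^+ (h + h).+1 * delta ^+ (m + m) + e + (h + m)%:R * kappa).
Proof.
move=> TK; pose I w c := inside (X w) (L w) (g c) (b c).
rewrite (exp_ext hE (g := fun w => \sum_(c | T \in g c) \sum_(c' | T \in g c')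
   (I w c * I w c'))); last first.
  move=> w; rewrite degE expr2 mulr_suml; apply: eq_bigr => c _.
  by rewrite mulr_sumr.
rewrite exp_sum //.
have -> : D%:R ^+ 2 * (p ^+ (h + h).+1 * delta ^+ (m + m) + e + (h + m)%:R * kappa) =
  \sum_(c | T \in g c) (D%:R * (p ^+ (h + h).+1 * delta ^+ (m + m) + e) + (h + m)%:R * (kappa * D%:R)).
  rewrite sumr_const -(g_deg hS TK) -[RHS]mulr_natl.
  by rewrite -sum1dep_card sum1_card; ring.
apply: ler_sum => c Tc; rewrite exp_sum //.
rewrite (bigID (fun c' => clean c c' T)) /=; apply: lerD.
  apply: (@le_trans _ _ (\sum_(c' | (T \in g c') && clean c c' T)
     (p ^+ (h + h).+1 * delta ^+ (m + m) + e))).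
    by apply: ler_sum => c' /andP[Tc' cl]; apply: pair_clean cl.
  have qe : 0 <= p ^+ (h + h).+1 * delta ^+ (m + m) + e.
    by case/andP: hp => ? _; case/andP: hd => ? _; rewrite addr_ge0 // mulr_ge0 // exprn_ge0.
  rewrite -(g_deg hS TK) -sumr1_card mulr_suml.
  rewrite big_mkcond [leRHS]big_mkcond /=; apply: ler_sum => c' _.
  by case: (T \in g c') => //=; rewrite mul1r; case: ifP.
apply: le_trans (unclean_few Tc); rewrite -sumr1_card; apply: ler_sum => c' _.
rewrite -[leRHS](exp_cst hE); apply: (exp_le hE) => w.
by rewrite /I insideM inside_le1.
Qed.

(** The degree vanishes when T is not live, so the expanded square needs only the two moments of
    [deg] and the probability that T is live. With y = p^h delta^m the main terms p y^2 - 2 p y^2 +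
    p y^2 cancel, and 4 e collects the errors e, 2 e y and e y^2. *)
Lemma deg_variance T : T \in K ->
  E (fun w => (T \in L w)%:R * (deg w T - mu) ^+ 2)
  <= D%:R ^+ 2 * (4 * e + (h + m)%:R * kappa).
Proof.
move=> TK.
rewrite (exp_ext hE (g := fun w => deg w T ^+ 2 - (2 * mu) * deg w T
   + mu ^+ 2 * inside (X w) (L w) [set T] set0)); last first.
  move=> w; rewrite /inside sub1set sub0set andbT.
  by case: (boolP (T \in L w)) => TL; rewrite ?(deg_live TL) //=; ring.
rewrite expD // expB // !expZ //.
have s2 := second_moment TK; have s1 := mean_deg TK.
have s0 : E (fun w => inside (X w) (L w) [set T] set0) <= p + e.
  have := q10 (A := [set T]) (B := set0); rewrite sub1set sub0set cards1 cards0.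
  have dis : [disjoint [set T] & set0] by rewrite disjoint_sym disjoints_subset sub0set.
  by move=> /(_ TK isT dis erefl erefl); rewrite ler_norml mulr1 expr1 => /andP[_]; lra.
have [p0 p1] := andP hp; have [d0 d1] := andP hd.
have P0 : 0 <= p ^+ h <= 1 by rewrite exprn_ge0 // exprn_ile1.
have Q0 : 0 <= delta ^+ m <= 1 by rewrite exprn_ge0 // exprn_ile1.
set Pw := p ^+ h in P0; set Qw := delta ^+ m in Q0.
set y := Pw * Qw; have y01 : 0 <= y <= 1.
  by have [? ?] := andP P0; have [? ?] := andP Q0; rewrite mulr_ge0 // mulr_ile1.
have e1 : p ^+ (h + h).+1 * delta ^+ (m + m) = p * y ^+ 2.
  by rewrite exprS !exprD /y -/Pw -/Qw; ring.
have e2 : p ^+ h.+1 * delta ^+ m = p * y by rewrite exprS /y -/Pw -/Qw; ring.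
rewrite e1 in s2; rewrite e2 in s1.
have Dn : 0 <= D%:R :> R by [].
have muE : mu = D%:R * y by [].
have mu0 : 0 <= mu by rewrite muE mulr_ge0 //; case/andP: y01.
have s1' := ler_wpM2l mu0 s1.
have s0' : mu ^+ 2 * E (fun w => inside (X w) (L w) [set T] set0) <= mu ^+ 2 * (p + e).
  by rewrite ler_wpM2l // exprn_ge0.
have [y0 y1] := andP y01.
have i1 : D%:R ^+ 2 * (e * y) <= D%:R ^+ 2 * e by rewrite ler_wpM2l ?exprn_ge0 // ler_piMr.
have i2 : D%:R ^+ 2 * (e * y ^+ 2) <= D%:R ^+ 2 * e.
  by rewrite ler_wpM2l ?exprn_ge0 // ler_piMr // exprn_ile1.
rewrite muE in s1' s0' *.
move: s1' s0' s2 i1 i2; set E2 := E _; set E1 := E _; set E0 := E _.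
set DD := D%:R : R.
rewrite !expr2 => *. nra.
Qed.

Definition touch w (A : {set V}) := [set c in good (X w) (L w) | ~~ [disjoint g c & A]].

(** A copy meeting [A] in d > 0 points is counted d times in the sum. The surplus d - 1 is paid for
    by pairs of distinct points of [A], that is, by codegrees. *)
Lemma touch_count (S : {set C}) (A : {set V}) : A \subset K ->
  (\sum_(T in A) #|[set c in S | T \in g c]|%:R : R)
   - #|[set c in S | ~~ [disjoint g c & A]]|%:R <= #|A|%:R ^+ 2 * (kappa * D%:R).
Proof.
move=> /subsetP AK; rewrite lerBlDl.
pose P T T' := [set c | (T \in g c) && (T' \in g c)].
apply: (@le_trans _ _ (#|[set c in S | ~~ [disjoint g c & A]]|
   + \sum_(T in A) \sum_(T' in A | T' != T) #|P T T'|)%N%:R).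
  rewrite -natr_sum ler_nat.
  under eq_bigr do rewrite card_set_sum.
  rewrite exchange_big /= card_set_sum.
  under [X in (_ <= _ + X)%N]eq_bigr do
    (under eq_bigr do rewrite card_set_sum; rewrite exchange_big /=).
  rewrite [X in (_ <= _ + X)%N]exchange_big /= -big_split /=; apply: leq_sum => c _.
  case: (c \in S) => /=; last by rewrite big1.
  have [dA|] := boolP [disjoint g c & A].
    by rewrite big1 // => T TA; rewrite (disjointFl dA).
  rewrite -setI_eq0 => /set0Pn[T0 /setIP[T0c T0A]].
  rewrite (bigD1 T0) //= T0c leq_add2l [leqRHS](bigD1 T0) //=.
  apply: leq_trans (leq_addr _ _); apply: leq_sum => T _.
  by rewrite T0c.
rewrite natrD lerD2l expr2 -mulrA natr_sum mulr_natl -sumr_const.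
apply: ler_sum => T TA; rewrite natr_sum.
have kD : 0 <= kappa * D%:R by rewrite mulr_ge0.
apply: (@le_trans _ _ (\sum_(T' in A | T' != T) (kappa * D%:R))).
  apply: ler_sum => T' /andP[T'A T'T].
  rewrite eq_sym in T'T; apply: le_trans (g_codeg hS (AK _ TA) (AK _ T'A) T'T).
  rewrite ler_nat; apply/subset_leq_card/subsetP => c; rewrite !inE.
  by move=> /andP[-> ->].
rewrite mulr_natl -sumr_const big_mkcondr /=.
by apply: ler_sum => T' _; case: ifP.
Qed.

Lemma touch_dist w N0 (A : {set V}) : A \subset K ->
  `|#|touch w A|%:R - (#|A| * N0)%:R| <=
    \sum_(T in A) `|deg w T - N0%:R| + #|A|%:R ^+ 2 * (kappa * D%:R).
Proof.
move=> AK.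
have kD : 0 <= #|A|%:R ^+ 2 * (kappa * D%:R) by rewrite !mulr_ge0 ?exprn_ge0.
have h1 := touch_count (good (X w) (L w)) AK.
have h2 : (#|touch w A|%:R : R) <= \sum_(T in A) deg w T.
  rewrite /deg -natr_sum ler_nat.
  apply: leq_trans (card_bigcup_le (fun T => T \in A) _).
  apply/subset_leq_card/subsetP => c; rewrite inE => /andP[cg].
  rewrite -setI_eq0 => /set0Pn[T /setIP[Tc TA]].
  by apply/bigcupP; exists T; rewrite // inE cg.
have h3 : `|\sum_(T in A) deg w T - (#|A| * N0)%:R| <= \sum_(T in A) `|deg w T - N0%:R|.
  rewrite natrM mulr_natl -sumr_const -sumrB; exact: ler_norm_sum.
move: h3; rewrite !ler_norml /touch /deg in h1 h2 * => /andP[h3 h4].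
by apply/andP; split; lra.
Qed.

(** The quantity inside E is the conditional probability that [A] survives a round: none of the
    copies touching [A] may be selected. Their number is close to [#|A| * N0]. The errors come from
    quasi-independence ([e]), from copies touching [A] twice ([kappa * theta]), from rounding the
    mean degree to the integer [N0] ([pi]), and from the variance of the degrees. *)
Lemma step_inside (i j N0 : nat) (theta pi alpha : R) (A B : {set V}) :
  quasi i j -> A \subset K -> B \subset K -> [disjoint A & B] ->
  #|A| = i -> #|B| = j -> 0 <= pi <= 1 -> pi * D%:R = theta -> 0 < alpha ->
  `|N0%:R - mu| <= 1 ->
  `|E (fun w => inside (X w) (L w) A B * (1 - pi) ^+ #|touch w A|)
     - (p * (1 - pi) ^+ N0) ^+ i * delta ^+ j|
  <= e + i%:R ^+ 2 * (kappa * theta)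
     + i%:R * (pi + (theta ^+ 2 * (4 * e + (h + m)%:R * kappa) / alpha + alpha) / 2).
Proof.
move=> qij AK BK AB Ai Bj /andP[pi0 pi1] piD al0 hN0.
set y := (1 - pi) ^+ N0.
have x01 : 0 <= 1 - pi <= 1 by lra.
have y0 : 0 <= y <= 1 by rewrite exprn_ge0 ?exprn_ile1 //; lra.
have yi : 0 <= y ^+ i <= 1.
  by case/andP: y0 => ? ?; rewrite exprn_ge0 // exprn_ile1.
pose I w := inside (X w) (L w) A B.
have main : `|E (fun w => I w * y ^+ i) - (p * y) ^+ i * delta ^+ j| <= e.
  rewrite (exp_ext hE (g := fun w => y ^+ i * I w)); last by move=> w; rewrite mulrC.
  rewrite expZ // exprMn_comm; last exact: mulrC.
  rewrite [p ^+ i * _]mulrC -mulrA -mulrBr normrM ger0_norm; last by case/andP: yi.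
  apply: le_trans (qij A B AK BK AB Ai Bj); rewrite ler_piMl //.
  by case/andP: yi.
pose err w := I w * ((1 - pi) ^+ #|touch w A| - y ^+ i).
have -> : E (fun w => inside (X w) (L w) A B * (1 - pi) ^+ #|touch w A|)
   = E (fun w => I w * y ^+ i) + E err.
  by rewrite -expD //; apply: (exp_ext hE) => w; rewrite /err /I; ring.
rewrite -[leRHS]addrA; set rest := (X in _ <= e + X).
suff hr : `|E err| <= rest.
  rewrite addrAC; apply: le_trans (ler_normD _ _) _.
  exact: lerD.
apply: le_trans (exp_norm hE _) _.
have pD0 : 0 <= i%:R ^+ 2 * (kappa * theta).
  by rewrite -piD !mulr_ge0 ?exprn_ge0.
pose dev w T := (T \in L w)%:R * (pi * `|deg w T - mu|).
have err_le w : `|err w| <= \sum_(T in A) (dev w T + pi) + i%:R ^+ 2 * (kappa * theta).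
  have I01 : 0 <= I w <= 1 by rewrite inside_ge0 inside_le1.
  rewrite /err normrM ger0_norm; last by case/andP: I01.
  rewrite -exprM.
  have := ler_distXn #|touch w A| (N0 * i) x01.
  rewrite subKr => hX.
  case: (boolP (A \subset L w)) => AL; last first.
    rewrite /I /inside (negPf AL) mul0r addr_ge0 // sumr_ge0 // => T _.
    by rewrite addr_ge0 // !mulr_ge0.
  apply: (@le_trans _ _ (pi * `|#|touch w A|%:R - (N0 * i)%:R|)).
    apply: le_trans hX; rewrite ler_piMl //; by case/andP: I01.
  have := ler_wpM2l pi0 (touch_dist w N0 AK); rewrite Ai mulnC => /le_trans; apply.
  rewrite mulrDr lerD //; last by rewrite -piD le_eqVlt; apply/orP; left; apply/eqP; ring.
  rewrite mulr_sumr; apply: ler_sum => T TA.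
  rewrite /dev (subsetP AL) // mul1r.
  have -> : deg w T - N0%:R = (deg w T - mu) - (N0%:R - mu) by ring.
  apply: le_trans (ler_wpM2l pi0 (ler_normB _ _)) _.
  by rewrite mulrDr lerD2l ler_piMr.
apply: le_trans (exp_le hE err_le) _.
rewrite expD // exp_cst // addrC lerD2l exp_sum //.
rewrite -[in leRHS]Ai mulr_natl -sumr_const; apply: ler_sum => T TA.
rewrite expD // exp_cst // addrC lerD2l.
(* The deviation is traded for its square by x <= x^2 / (2 alpha) + alpha / 2, which takes the place
   of Cauchy-Schwarz and needs no square root. *)
have dev_le w : dev w T <=
    (pi ^+ 2 / (2 * alpha)) * ((T \in L w)%:R * (deg w T - mu) ^+ 2) + alpha / 2.
  rewrite /dev; case: (T \in L w); rewrite ?mul0r ?mulr0 ?mul1r ?add0r; last by lra.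
  rewrite -(@real_normK _ (deg w T - mu)) ?num_real //; set x := `|_|.
  have -> : pi ^+ 2 / (2 * alpha) * x ^+ 2 + alpha / 2 =
    pi * x + (pi * x - alpha) ^+ 2 / (2 * alpha) by field; rewrite gt_eqF.
  by rewrite lerDl divr_ge0 ?sqr_ge0 //; lra.
apply: le_trans (exp_le hE dev_le) _.
rewrite expD // exp_cst // expZ // [leRHS]mulrDl lerD2r.
have c0 : 0 <= pi ^+ 2 / (2 * alpha) by rewrite divr_ge0 ?exprn_ge0 //; lra.
have TK := subsetP AK _ TA.
apply: le_trans (ler_wpM2l c0 (deg_variance TK)) _.
rewrite -piD le_eqVlt; apply/orP; left; apply/eqP; field; rewrite gt_eqF //.
Qed.

End Step.
End Structure.

(** * Iterated rounds *)

Section Process.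
Variables (R : archiRealFieldType) (V C : finType) (K : {set V}) (g b : C -> {set V}).
Variables (delta pi : R).

(** The latest round comes first. A selected usable copy removes its sets even if it clashes with
    another selected copy, so that survival of [A] means exactly that no copy touching [A] is
    selected. *)
Fixpoint live (X : {set V}) (ws : seq {set C}) : {set V} :=
  if ws is Y :: ws' then
    live X ws' :\: \bigcup_(c in Y :&: good g b X (live X ws')) g c
  else K :\: X.

(** The sacrificed set is drawn first, with density [delta], then each round draws copies with
    probability [pi]. The last round is averaged innermost, that is, conditionally on the earlier
    ones. *)
Fixpoint rounds (n : nat) (F : {set V} * seq {set C} -> R) : R :=
  if n is n'.+1 then
    rounds n' (fun w => bern pi (fun S => F (w.1, S :: w.2)))
  else bern delta (fun X => F (X, [::])).

Lemma rounds_expectation n : 0 <= delta <= 1 -> 0 <= pi <= 1 -> expectation (rounds n).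
Proof.
move=> hd hp; elim: n => [|n IH].
  have hE := bern_expectation V hd; split=> /= [f g'|a f|f g' fg|].
  - exact: expD.
  - exact: expZ.
  - by apply: exp_le => // X; apply: fg.
  - exact: exp1.
have hE := bern_expectation C hp; split=> /= [f g'|a f|f g' fg|].
- by rewrite -expD //; apply: exp_ext => // w; rewrite expD.
- by rewrite -expZ //; apply: exp_ext => // w; rewrite expZ.
- by do 2!apply: exp_le => // ?; apply: fg.
- by rewrite -[RHS](exp1 IH); apply: exp_ext => // w; rewrite exp1.
Qed.

Lemma rounds_exists n F c : 0 <= delta <= 1 -> 0 <= pi <= 1 ->
  c <= rounds n F -> exists w, c <= F w.
Proof.
move=> hd hp; elim: n F => [|n IH] F /=.
  by move=> /(bern_exists hd)[X cX]; exists (X, [::]).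
by move=> /IH[w] /(bern_exists hp)[Y cY]; exists (w.1, Y :: w.2).
Qed.

Lemma inside_step X S ws A B :
  inside R X (live X (S :: ws)) A B =
  inside R X (live X ws) A B *
    [disjoint touch g b fst (fun w => live w.1 w.2) (X, ws) A & S]%:R.
Proof.
rewrite /inside -natrM mulnb; congr (_%:R)%R.
rewrite /= subsetD -!andbA; congr (nat_of_bool (_ && _)); rewrite [LHS]andbC.
congr (_ && _).
apply/idP/idP => [/pred0P dis|/pred0P dis].
  apply/pred0P => c /=; apply/negP => /andP[]; rewrite inE => /andP[cg].
  rewrite -setI_eq0 => /set0Pn[T /setIP[Tc TA]] cS.
  have := dis T; rewrite /= TA => /negP; apply.
  by apply/bigcupP; exists c; rewrite // inE cS.
apply/pred0P => T /=; apply/negP => /andP[TA /bigcupP[c /setIP[cS cg] Tc]].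
have := dis c; rewrite /= cS andbT => /negP; apply.
by rewrite inE cg /= -setI_eq0; apply/set0Pn; exists T; rewrite inE Tc.
Qed.

(** The predicted probability that a k-set is live after n rounds. The exponent is the predicted
    number of usable copies at a live set, truncated to an integer so that it can serve as [N0] in
    [step_inside]. *)
Fixpoint density (D h m n : nat) : R :=
  if n is n'.+1 then
    density D h m n' *
      (1 - pi) ^+ Num.truncn (D%:R * (density D h m n' ^+ h * delta ^+ m))
  else 1 - delta.

Lemma density_itv D h m n : 0 <= delta <= 1 -> 0 <= pi <= 1 ->
  0 <= density D h m n <= 1.
Proof.
move=> hd hp; elim: n => [|n IH] /=; first by lra.
have [p0 p1] := andP IH.
have x0 : 0 <= (1 - pi) ^+ Num.truncn (D%:R * (density D h m n ^+ h * delta ^+ m)) <= 1.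
  by rewrite exprn_ge0 ?exprn_ile1 //; lra.
by case/andP: x0 => *; rewrite mulr_ge0 // mulr_ile1.
Qed.

End Process.

(** Induction on the number of rounds, simultaneously for all [i], [j] and [eta]. One more round at
    (i, j) uses the previous state at (i, j) and, for the variance of the degrees, at (1, 0), (h+1,
    m) and (2h+1, 2m), all with a smaller error. The threshold [k0] depends on none of the sets. *)
Lemma rounds_quasi (R : archiRealFieldType) (h m : nat) (theta delta : R) (n i j : nat) (eta : R) :
  0 <= delta <= 1 -> 0 <= theta -> 0 < eta ->
  exists2 k0 : R, 0 < k0 & forall (V C : finType) (K : {set V}) (g b : C -> {set V})
    (D : nat) (kappa : R), regular_system K g b h m D kappa ->
    0 <= kappa <= k0 -> 1 <= k0 * D%:R ->
    quasi K (rounds delta (theta / D%:R) n) fst (fun w => live K g b w.1 w.2)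
      (density delta (theta / D%:R) D h m n) delta eta i j.
Proof.
move=> hd th0; elim: n i j eta => [|n IH] i j eta eta0.
  exists 1 => // V C K g b D kappa hS _ _ A B AK BK AB Ai Bj /=.
  rewrite (_ : bern _ _ = delta ^+ j * (1 - delta) ^+ i).
    by rewrite [delta ^+ j * _]mulrC subrr normr0 ltW.
  rewrite -Ai -Bj -bern_avoid; last by rewrite disjoint_sym.
  apply: eq_bigr => X _; congr (_ * _); rewrite /inside /= subsetD AK /=.
  by rewrite andbC.
pose I : R := i.+1%:R.
have I1 : 1 <= I by rewrite ler1n.
(* The parameter of the quadratic bound in [step_inside], which contributes I al / 2 = eta / 4. The
   constant [Cst] below collects the coefficients of the previous error [x], chosen with x Cst = eta
   / 2. *)
pose al := eta / (2 * I).
have al0 : 0 < al by rewrite divr_gt0 //; lra.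
pose hm : R := (h + m)%:R.
have hm0 : 0 <= hm by [].
pose Cst := 1 + I ^+ 2 * theta + I + I * (theta ^+ 2 * (4 + hm) / al / 2).
have Cst1 : 1 <= Cst.
  have u1 : 0 <= I ^+ 2 * theta by rewrite mulr_ge0 ?sqr_ge0.
  have u2 : 0 <= I * (theta ^+ 2 * (4 + hm) / al / 2).
    rewrite mulr_ge0 ?divr_ge0 ?mulr_ge0 ?sqr_ge0 ?(ltW al0) //; lra.
  by rewrite /Cst; lra.
pose x := eta / (2 * Cst).
have x0 : 0 < x by rewrite divr_gt0 //; lra.
have [k1 k10 H1] := IH 1%N 0%N x x0.
have [k2 k20 H2] := IH h.+1 m x x0.
have [k3 k30 H3] := IH (h + h).+1 (m + m)%N x x0.
have [k4 k40 H4] := IH i j x x0.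
pose k5 := Num.min x 1 / (theta + 1).
have k50 : 0 < k5 by rewrite divr_gt0 ?lt_min ?x0 ?ltr01 //; lra.
exists (Num.min x (Num.min k5 (Num.min (Num.min k1 k2) (Num.min k3 k4)))).
  by rewrite !lt_min x0 k50 k10 k20 k30 k40.
set k0 := Num.min x _.
have [[l0 l1 l2] [l3 l4 l5]] :
    [/\ k0 <= x, k0 <= k1 & k0 <= k2] /\ [/\ k0 <= k3, k0 <= k4 & k0 <= k5].
  by do 2!split; rewrite /k0 !ge_min lexx ?orbT.
move=> V C K g b D kappa hS /andP[kap0 kapk] kD.
have Dgt : (0 : R) < D%:R.
  rewrite ltr0n lt0n; apply/eqP => D0; move: kD; rewrite D0 mulr0; lra.
have up k : k0 <= k -> 1 <= k * D%:R.
  by move=> kk; apply: le_trans kD _; rewrite ler_wpM2r // ltW.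
have kp k : k0 <= k -> 0 <= kappa <= k by move=> kk; rewrite kap0 (le_trans kapk).
have Q1 := H1 _ _ _ _ _ _ _ hS (kp _ l1) (up _ l1).
have Q2 := H2 _ _ _ _ _ _ _ hS (kp _ l2) (up _ l2).
have Q3 := H3 _ _ _ _ _ _ _ hS (kp _ l3) (up _ l3).
have Q4 := H4 _ _ _ _ _ _ _ hS (kp _ l4) (up _ l4).
set pi := theta / D%:R in Q1 Q2 Q3 Q4 *.
have piD : pi * D%:R = theta by rewrite /pi divfK // gt_eqF.
have pi0 : 0 <= pi by rewrite divr_ge0 // ltW.
have pik : pi <= Num.min x 1.
  have := up _ l5; rewrite /k5 mulrAC ler_pdivlMr; last by lra.
  by rewrite mul1r /pi ler_pdivrMr // => ?; lra.
have [pix pi1] : pi <= x /\ pi <= 1 by move: pik; rewrite le_min => /andP[].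
have pi01 : 0 <= pi <= 1 by rewrite pi0.
have hE := rounds_expectation V C n hd pi01.
have hp := density_itv D h m n hd pi01.
move=> A B AK BK AB Ai Bj /=.
have hN : `|(Num.truncn (D%:R * (density delta pi D h m n ^+ h * delta ^+ m)))%:R
   - D%:R * (density delta pi D h m n ^+ h * delta ^+ m)| <= 1.
  have /truncn_itv : 0 <= D%:R * (density delta pi D h m n ^+ h * delta ^+ m).
    case/andP: hp => ? _; case/andP: hd => ? _.
    by rewrite !mulr_ge0 ?exprn_ge0 // ltW.
  rewrite -addn1 natrD => /andP[t1 t2]; rewrite ler_norml; lra.
have := step_inside hS hE hp hd (ltW x0) kap0 Q1 Q2 Q3 Q4 AK BK AB Ai Bj pi01 piD al0 hN.
rewrite (exp_ext hE (g := fun w => bern pi (fun S => inside R w.1 (live K g b w.1 (S :: w.2)) A B))); last first.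
  move=> [X ws] /=; rewrite -bern_disj -(expZ (bern_expectation C pi01)).
  by apply: (exp_ext (bern_expectation C pi01)) => S; rewrite -inside_step.
move=> /le_trans; apply.
have iI : i%:R <= I by rewrite ler_nat.
have i0 : 0 <= i%:R :> R by [].
have kx : kappa <= x by apply: le_trans kapk l0.
have t2 : i%:R ^+ 2 * (kappa * theta) <= I ^+ 2 * (x * theta).
  by rewrite ler_pM ?sqr_ge0 ?mulr_ge0 // ?ler_pM // lerXn2r ?nnegrE //; lra.
have t3 : theta ^+ 2 * (4 * x + hm * kappa) / al <= theta ^+ 2 * (4 + hm) / al * x.
  rewrite [leRHS]mulrAC ler_pM2r ?invr_gt0 // -[leRHS]mulrA ler_wpM2l ?sqr_ge0 // [leRHS]mulrDl lerD2l.
  by rewrite ler_wpM2l.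
have t4 : i%:R * (pi + (theta ^+ 2 * (4 * x + hm * kappa) / al + al) / 2) <=
   I * (x + (theta ^+ 2 * (4 + hm) / al * x + al) / 2).
  apply: (@le_trans _ _ (i%:R * (x + (theta ^+ 2 * (4 + hm) / al * x + al) / 2))).
    by rewrite ler_wpM2l //; lra.
  rewrite ler_wpM2r // addr_ge0 ?(ltW x0) // divr_ge0 // addr_ge0 ?(ltW al0) //.
  by rewrite mulr_ge0 ?(ltW x0) // divr_ge0 ?(ltW al0) // mulr_ge0 ?sqr_ge0 //; lra.
apply: le_trans (lerD (lerD (lexx x) t2) t4) _.
have -> : x + I ^+ 2 * (x * theta) + I * (x + (theta ^+ 2 * (4 + hm) / al * x + al) / 2)
  = x * Cst + I * al / 2 by rewrite /Cst; field; rewrite gt_eqF.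
have -> : x * Cst = eta / 2 by rewrite /x; field; rewrite gt_eqF //; lra.
have -> : I * al = eta / 2 by rewrite /al; field; rewrite gt_eqF //; lra.
lra.
Qed.

(** The product is extended to all of [T] by factors 0 + 1 outside [Z]; they kill every [J] not
    contained in [Z]. *)
Lemma prod_addr_subsets (R : comRingType) (T : finType) (Z : {set T}) (x y : T -> R) :
  \prod_(i in Z) (x i + y i) =
  \sum_(J : {set T} | J \subset Z) (\prod_(i in J) x i) * \prod_(i in Z :\: J) y i.
Proof.
pose F i : R := if i \in Z then x i else 0.
pose G i : R := if i \in Z then y i else 1.
transitivity (\prod_i (F i + G i)).
  by rewrite big_mkcond; apply: eq_bigr => i _; rewrite /F /G; case: ifP; rewrite ?add0r.
rewrite (@bigA_distr R 0 1 *%R +%R) [RHS]big_mkcond /=; apply: eq_bigr => J _.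
case: ifP => [/subsetP JZ|/negbT/subsetPn[i iJ iZ]]; last first.
  by rewrite (bigD1 i) //= iJ /F (negPf iZ) mul0r.
rewrite [X in _ = X * _]big_mkcond [X in _ = _ * X]big_mkcond /= -big_split /=.
apply: eq_bigr => i _; rewrite in_setD /F /G.
by case: (boolP (i \in J)) => [/JZ ->|_] /=; rewrite ?mulr1 ?mul1r.
Qed.

(** * Accepted copies and the potential *)

Section Accepted.
Variables (R : archiRealFieldType) (V C : finType) (K : {set V}) (g b : C -> {set V}).
Variables (h m D : nat) (kappa delta pi : R).
Hypothesis hS : regular_system K g b h m D kappa.
Hypotheses (hd : 0 <= delta <= 1) (hpi : 0 <= pi <= 1).

Local Notation live := (live K g b).
Local Notation good := (good g b).

Definition isolated (Y : {set C}) :=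
  [set c in Y | [forall c' in Y, (c' != c) ==> [disjoint g c & g c']]].

Definition clashes (Y : {set C}) :=
  [set q : C * C | [&& q.1 \in Y, q.2 \in Y, q.2 != q.1 & ~~ [disjoint g q.1 & g q.2]]].

Fixpoint accepted (X : {set V}) (ws : seq {set C}) : {set C} :=
  if ws is Y :: ws' then
    accepted X ws' :|: isolated (Y :&: good X (live X ws'))
  else set0.

Definition used (ws : seq {set C}) : {set C} := \bigcup_(Y <- ws) Y.

Lemma live_sub X ws : live X ws \subset K :\: X.
Proof.
elim: ws => [|Y ws IH] //=; apply: subset_trans (subsetDl _ _) IH.
Qed.

Lemma accepted_used X ws : accepted X ws \subset used ws.
Proof.
elim: ws => [|Y ws IH] /=; first exact: sub0set.
rewrite /used big_cons subUset (subset_trans IH (subsetUr _ _)) /=.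
apply: subset_trans (subsetUl _ _); apply/subsetP => c; rewrite inE => /andP[].
by rewrite inE => /andP[].
Qed.

(** The last clause carries the disjointness of the packing across rounds: later copies use live
    sets only, and the sets of an accepted copy are no longer live. *)
Lemma accepted_spec X ws c : c \in accepted X ws ->
  [/\ g c \subset K :\: X, b c \subset X & [disjoint g c & live X ws]].
Proof.
elim: ws => [|Y ws IH] /=; first by rewrite inE.
case/setUP => [/IH[gc bc dis]|].
  split=> //; apply: disjointWr dis; exact: subsetDl.
rewrite inE => /andP[cYg _]; have := cYg; rewrite !inE => /and3P[cY gc bc].
split=> //; first exact: subset_trans gc (live_sub _ _).
apply/pred0P => T /=; apply/negP => /andP[Tc /setDP[_ /negP TN]].
by apply: TN; apply/bigcupP; exists c.
Qed.

Lemma accepted_disj X ws : {in accepted X ws &, forall c c', c != c' ->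
  [disjoint g c & g c']}.
Proof.
elim: ws => [|Y ws IH] /= c c'; first by rewrite inE.
have key c0 c1 : c0 \in accepted X ws ->
    c1 \in isolated (Y :&: good X (live X ws)) -> [disjoint g c0 & g c1].
  move=> /accepted_spec[_ _ dis]; rewrite !inE => /andP[/and3P[_ gc _] _].
  exact: disjointWr gc dis.
case/setUP=> hc; case/setUP => hc' cc'.
- exact: IH.
- exact: key.
- by rewrite disjoint_sym; apply: key.
- move: hc hc'; rewrite inE => /andP[_ /forall_inP H]; rewrite inE => /andP[c'Y _].
  by have /implyP := H _ c'Y; apply; rewrite eq_sym.
Qed.

Lemma accepted_card X Y ws : #|accepted X (Y :: ws)| =
  (#|accepted X ws| + #|isolated (Y :&: good X (live X ws))|)%N.
Proof.
rewrite /= -cardsUI; rewrite (_ : accepted X ws :&: _ = set0) ?cards0 ?addn0 //.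
apply/setP => c; rewrite in_setI in_set0; apply/negP => /andP[/accepted_spec[_ _ dis]].
rewrite !inE => /andP[/and3P[_ gc _] _].
have : [disjoint g c & g c] by apply: disjointWr gc dis.
rewrite -setI_eq0 setIid -cards_eq0 (g_card hS) //.
Qed.

Lemma isolated_card (Y S : {set C}) : S \subset Y ->
  (#|S| <= #|isolated S| + #|clashes Y|)%N.
Proof.
move=> /subsetP SY; rewrite -(cardsID (isolated S) S) leq_add //.
  by apply/subset_leq_card/subsetIr.
apply: leq_trans (leq_imset_card fst _); apply/subset_leq_card/subsetP => c.
rewrite !inE => /andP[+ cS]; rewrite cS /= => /forall_inPn[c' c'S].
rewrite negb_imply => /andP[cc' dis]; apply/imsetP; exists (c, c') => //.
by rewrite inE /= cc' dis !SY.
Qed.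

(* A k-set leaves the live set because of a chosen copy, which is accepted unless
   it clashes; so the potential drops only through clashes, a second-order effect. *)
Definition potential X ws : R := h.+1%:R * #|accepted X ws|%:R + #|live X ws|%:R.

Lemma potential_step X Y ws :
  potential X ws <= potential X (Y :: ws) + h.+1%:R * #|clashes Y|%:R.
Proof.
rewrite /potential accepted_card -!natrM -!natrD ler_nat mulnDr.
set S := Y :&: good X (live X ws).
have S1 : (#|live X ws| <= #|live X (Y :: ws)| + h.+1 * #|S|)%N.
  rewrite -(cardsID (\bigcup_(c in S) g c) (live X ws)) addnC leq_add2l.
  apply: leq_trans (subset_leq_card (subsetIr _ _)) _.
  apply: leq_trans (card_bigcup_le (fun c => c \in S) g) _.
  rewrite (eq_bigr (fun=> h.+1)); first by rewrite sum_nat_const mulnC.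
  by move=> c _; rewrite (g_card hS).
have S2 := isolated_card (subsetIl Y (good X (live X ws))).
rewrite -/S in S2; have S3 := leq_mul (leqnn h.+1) S2; rewrite mulnDr in S3.
by rewrite -/S; lia.
Qed.

(** A clashing ordered pair shares some T in [K], which allows at most |K| D^2 pairs, and each pair
    is selected with probability pi^2. *)
Lemma clashes_mean :
  bern pi (fun Y => #|clashes Y|%:R) <= #|K|%:R * (pi * D%:R) ^+ 2.
Proof.
have hE := bern_expectation C hpi.
pose P (q : C * C) := (q.2 != q.1) && ~~ [disjoint g q.1 & g q.2].
rewrite (exp_ext hE (g := fun Y => \sum_(q | P q) ([set q.1; q.2] \subset Y)%:R)); last first.
  move=> Y; rewrite -natr_sum card_set_sum; congr (_%:R)%R.
  rewrite [RHS]big_mkcond; apply: eq_bigr => q _; rewrite subUset !sub1set /P.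
  by case: (_ \in _); case: (_ \in _); case: (_ != _); case: [disjoint _ & _].
rewrite exp_sum // (eq_bigr (fun=> pi ^+ 2)); last first.
  by move=> q /andP[q12 _]; rewrite bern_sub cards2 eq_sym q12.
rewrite sumr_const exprMn_comm; last exact: mulrC.
rewrite -[leLHS]mulr_natr [leRHS]mulrCA ler_wpM2l ?sqr_ge0 //.
rewrite -natrX -natrM ler_nat.
have cs : (#|[pred q | P q]| <= \sum_(T in K) #|[set c | T \in g c]| * #|[set c | T \in g c]|)%N.
  apply: (@leq_trans #|\bigcup_(T in K)
      [set q : C * C | (T \in g q.1) && (T \in g q.2)]|).
    rewrite -cardsE; apply/subset_leq_card/subsetP => q.
    rewrite inE => /andP[_]; rewrite -setI_eq0 => /set0Pn[T /setIP[T1 T2]].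
    apply/bigcupP; exists T; last by rewrite inE T1.
    by have /subsetP := g_sub hS q.1; apply.
  apply: leq_trans (card_bigcup_le (fun T => T \in K) _) _.
  apply: leq_sum => T _; rewrite -cardsX; apply/subset_leq_card/subsetP => q.
  by rewrite !inE.
apply: leq_trans cs _; rewrite (eq_bigr (fun=> D * D)%N) ?sum_nat_const //.
by move=> T TK; rewrite (g_deg hS).
Qed.

Lemma mean_potential n :
  (1 - delta) * #|K|%:R - n%:R * (h.+1%:R * (#|K|%:R * (pi * D%:R) ^+ 2))
  <= rounds delta pi n (fun w => potential w.1 w.2).
Proof.
elim: n => [|n IH] /=.
  have hE := bern_expectation V hd.
  rewrite mul0r subr0 (exp_ext hE (g := fun X => \sum_(T in K) [disjoint [set T] & X]%:R)).
    rewrite exp_sum // (eq_bigr (fun=> 1 - delta)); first by rewrite sumr_const mulr_natr.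
    by move=> T _; rewrite bern_disj cards1 expr1.
  move=> X; rewrite /potential /= cards0 mulr0 add0r -natr_sum; congr (_%:R)%R.
  rewrite -sum1_card big_mkcond [RHS]big_mkcond /=; apply: eq_bigr => T _.
  by rewrite in_setD disjoints_subset sub1set in_setC andbC; case: (T \in K) => //; case: (T \in X).
have hE := bern_expectation C hpi; have hR := rounds_expectation V C n hd hpi.
set x := h.+1%:R * _ in IH *.
apply: (@le_trans _ _ (rounds delta pi n (fun w => potential w.1 w.2 - x))).
  by rewrite expB // exp_cst // -addn1 natrD; lra.
apply: (exp_le hR) => -[X ws] /=.
apply: (@le_trans _ _ (bern pi (fun Y => potential X ws - h.+1%:R * #|clashes Y|%:R))).
  rewrite expB // exp_cst // expZ // lerD2l lerN2 ler_wpM2l //.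
  exact: clashes_mean.
by apply: (exp_le hE) => Y; rewrite lerBlDr; apply: potential_step.
Qed.

(** Split [Z] into the part [J] chosen in the last round and the part chosen earlier. The resulting
    sum over [J] is the expansion of (pi + n pi)^|Z|. *)
Lemma rounds_used n (Z : {set C}) :
  rounds delta pi n (fun w : {set V} * _ => (Z \subset used w.2)%:R) <= (n%:R * pi) ^+ #|Z|.
Proof.
have hE := bern_expectation C hpi.
elim: n Z => [|n IH] Z /=.
  have hX := bern_expectation V hd.
  rewrite exp_cst // /used big_nil subset0 mul0r -cards_eq0.
  by case: #|Z| => [|k]; rewrite ?expr0 // exprS mul0r.
have hR := rounds_expectation V C n hd hpi.
apply: (@le_trans _ _ (rounds delta pi n (fun w : {set V} * _ =>
   \sum_(J : {set C} | J \subset Z) pi ^+ #|J| * (Z :\: J \subset used w.2)%:R))).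
  apply: (exp_le hR) => -[X ws] /=.
  apply: (@le_trans _ _ (bern pi (fun Y => \sum_(J : {set C} | J \subset Z)
    (Z :\: J \subset used ws)%:R * (J \subset Y)%:R))).
    apply: (exp_le hE) => Y; rewrite /used big_cons -/(used ws).
    case: (boolP (_ \subset _)) => [/subsetP ZU|_]; last by apply: sumr_ge0 => J _; rewrite mulr_ge0.
    (* The term for [J = Z :&: Y] equals 1 and all the others are nonnegative. *)
    rewrite (bigD1 (Z :&: Y)) ?subsetIl //= (_ : Z :\: (Z :&: Y) \subset used ws).
      by rewrite subsetIr mul1r lerDl sumr_ge0 // => J _; rewrite mulr_ge0.
    apply/subsetP => c; rewrite !inE negb_and => /andP[+ cZ]; rewrite cZ /= => cY.
    by have := ZU _ cZ; rewrite inE (negPf cY).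
  rewrite exp_sum //; apply: ler_sum => J _.
  by rewrite expZ // bern_sub mulrC.
rewrite exp_sum //.
have -> : (n.+1%:R * pi) ^+ #|Z| = \prod_(i in Z) (pi + n%:R * pi).
  by rewrite prodr_const -natr1 mulrDl mul1r addrC.
rewrite prod_addr_subsets; apply: ler_sum => J JZ.
rewrite expZ // !prodr_const ler_wpM2l //; case/andP: hpi => ? _; exact: exprn_ge0.
Qed.

End Accepted.

(** While the density is at least [eps], a round divides it by at least 1 + tau, so density times 1
    + n tau stays at most 1. Once below [eps] it stays there. *)
Lemma density_small (R : archiRealFieldType) (delta pi tau eps : R) (D h m n : nat) :
  0 <= eps -> 0 <= delta <= 1 -> 0 <= pi <= 1 -> 0 <= tau ->
  (forall p, eps <= p -> tau <= pi * (Num.truncn (D%:R * (p ^+ h * delta ^+ m)))%:R) ->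
  1 <= eps * (n%:R * tau) -> density delta pi D h m n <= eps.
Proof.
move=> eps0 hd hpi tau0 H hn.
suff [//|X] : density delta pi D h m n <= eps \/
              density delta pi D h m n * (1 + n%:R * tau) <= 1.
  have /andP[d0 _] := density_itv D h m n hd hpi.
  move: X hn; set d := density _ _ _ _ _ _ in d0 *; set x := n%:R * tau => X hn.
  have x0 : 0 <= x by rewrite mulr_ge0.
  rewrite leNgt; apply/negP => ed.
  have : eps * x <= d * x by rewrite ler_wpM2r // ltW.
  lra.
elim: {hn} n => [|n [IH|IH]] /=.
- by right; case/andP: hd => *; lra.
- left; apply: le_trans IH; have /andP[d0 _] := density_itv D h m n hd hpi.
  by rewrite ler_piMr // exprn_ile1; lra.
have [dn|/ltW dn] := leP (density delta pi D h m n) eps.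
  left; apply: le_trans dn; have /andP[d0 _] := density_itv D h m n hd hpi.
  by rewrite ler_piMr // exprn_ile1; lra.
right; set N := Num.truncn _; have tN : tau <= pi * N%:R := H _ dn.
have [pi0 pi1] := andP hpi.
(* This follows from (1 - pi)^N (1 + pi)^N <= 1 and Bernoulli's inequality for the second factor. *)
have yb : (1 - pi) ^+ N * (1 + tau) <= 1.
  apply: (@le_trans _ _ ((1 - pi) ^+ N * (1 + pi) ^+ N)).
    rewrite ler_wpM2l ?exprn_ge0 //; first lra.
    apply: (@le_trans _ _ (1 + pi * N%:R)); first lra.
    elim: (N) => [|k IHk]; first by rewrite mulr0 addr0 expr0.
    rewrite exprS -natr1 mulrDr mulr1.
    have : (1 + pi) * (1 + pi * k%:R) <= (1 + pi) * (1 + pi) ^+ k by rewrite ler_wpM2l //; lra.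
    have : 0 <= pi * (pi * k%:R) by rewrite !mulr_ge0.
    lra.
  rewrite -exprMn_comm; last exact: mulrC.
  by rewrite exprn_ile1 //; nra.
have /andP[d0 _] := density_itv D h m n hd hpi.
move: IH yb d0; set d := density _ _ _ _ _ _; set y := (1 - pi) ^+ N => IH yb d0.
have y0 : 0 <= y by rewrite exprn_ge0 //; lra.
have x0 : 0 <= n%:R * tau by rewrite mulr_ge0.
rewrite -natr1 mulrDl mul1r; set x := n%:R * tau in IH x0 *.
apply: (@le_trans _ _ ((d * (1 + x)) * (y * (1 + tau)))); last by rewrite mulr_ile1 // mulr_ge0 //; lra.
have : 0 <= d * y * (x * tau) by rewrite !mulr_ge0.
lra.
Qed.

(** The rounds are run with delta = eps and pi = th / D. A forbidden set Z is selected with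
    probability at most (lam / D)^|Z|, where lam = n th, so the hypothesis on [ZZ] bounds the
    expected number of selected forbidden sets. Some outcome has a large potential with few live and
    few forbidden sets, and one copy of each forbidden set is deleted. *)
Theorem nibble (R : archiRealFieldType) (h m : nat) (eps : R) : 0 < eps < 1 ->
  exists lam k0 : R, [/\ 0 < lam, 0 < k0 &
    forall (V C : finType) (K : {set V}) (g b : C -> {set V}) (D : nat) (kappa : R)
      (ZZ : {set {set C}}),
    regular_system K g b h m D kappa -> 0 <= kappa <= k0 -> 1 <= k0 * D%:R ->
    set0 \notin ZZ ->
    h.+1%:R * \sum_(Z in ZZ) (lam / D%:R) ^+ #|Z| <= eps * #|K|%:R ->
    exists (X : {set V}) (M : {set C}), [/\
      forall c, c \in M -> g c \subset K :\: X /\ b c \subset X,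
      {in M &, forall c c', c != c' -> [disjoint g c & g c']},
      forall Z, Z \in ZZ -> ~~ (Z \subset M) &
      (1 - 5 * eps) * #|K|%:R <= h.+1%:R * #|M|%:R]].
Proof.
move=> /andP[e0 e1].
pose H : R := h.+1%:R.
have H1 : 1 <= H by rewrite ler1n.
(* As long as the density p is at least eps, the predicted degree D p^h eps^m is at least D z. *)
pose z : R := eps ^+ (h + m).
have z0 : 0 < z by rewrite exprn_gt0.
have z1 : z <= 1 by rewrite exprn_ile1 // ltW.
(* This choice makes all clashes together cost at most eps: n th <= 2 / (eps z) + 1 gives n H th^2
   <= eps. *)
pose th := eps / (H * (2 / (eps * z) + 1)).
have ez0 : 0 < eps * z by rewrite mulr_gt0.
have th0 : 0 < th.
  rewrite divr_gt0 // mulr_gt0 ?addr_gt0 ?divr_gt0 //; lra.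
have th1 : th <= 1.
  rewrite /th ler_pdivrMr ?mul1r; last first.
    by rewrite mulr_gt0 ?addr_gt0 ?divr_gt0 //; lra.
  have : 0 <= 2 / (eps * z) by rewrite divr_ge0 // ltW.
  nra.
(* The rate of decrease per round. Half of th z is given up to the truncation of the degree, which
   costs pi <= tau. *)
pose tau := th * z / 2.
have tau0 : 0 < tau by apply: divr_gt0 => //; apply: mulr_gt0.
(* Enough rounds to have 1 <= eps n tau, as [density_small] requires. *)
pose n := (Num.truncn (1 / (eps * tau))).+1.
have et0 : 0 < eps * tau by rewrite mulr_gt0.
have /andP[n1 n2] : (1 / (eps * tau) <= n%:R) && (n%:R <= 1 / (eps * tau) + 1).
  have /truncn_itv : 0 <= 1 / (eps * tau) by rewrite divr_ge0 ?ltW.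
  by rewrite /n -natr1 => /andP[t1 /ltW ->]; rewrite lerD2r.
have hd : 0 <= eps <= 1 by rewrite !ltW.
have [k1 k10 Q] := rounds_quasi h m n 1 0 hd (ltW th0) e0.
exists (n%:R * th), (Num.min k1 (z / 2)); split.
- by rewrite mulr_gt0.
- by rewrite lt_min k10 divr_gt0.
move=> V C K g b D kappa ZZ hS /andP[kap0 kapk] kD Z0 Zsum.
move: kapk; rewrite le_min => /andP[kapk1 kapk2].
have le_k k : Num.min k1 (z / 2) <= k -> 1 <= k * D%:R.
  by move=> kk; apply: le_trans kD _; rewrite ler_wpM2r.
have [Ddiv D1] : 1 <= z / 2 * D%:R /\ 1 <= k1 * D%:R.
  by split; apply: le_k; rewrite ge_min lexx ?orbT.
have D0 : 0 < D%:R :> R.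
  by rewrite ltr0n lt0n; apply/eqP => D0; move: Ddiv; rewrite D0 mulr0; lra.
have D1' : 1 <= D%:R :> R by rewrite ler1n -(ltr0n R D).
pose pi := th / D%:R.
have piD : pi * D%:R = th by rewrite /pi divfK // gt_eqF.
have pi0 : 0 <= pi by rewrite divr_ge0 // ltW.
have pi1 : pi <= 1 by rewrite ler_pdivrMr // mul1r; lra.
have hpi : 0 <= pi <= 1 by rewrite pi0.
have pit : pi <= tau.
  rewrite /pi /tau ler_pdivrMr //.
  have : th * 1 <= th * (z / 2 * D%:R) by rewrite ler_wpM2l // ltW.
  by rewrite mulr1 !mulrA.
have hE := rounds_expectation V C n hd hpi.
have dens : density eps pi D h m n <= eps.
  apply: (density_small (ltW e0) hd hpi (ltW tau0)); last first.
    have := n1; rewrite ler_pdivrMr //; lra.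
  move=> p ep; set x := D%:R * _.
  have xl : D%:R * z <= x.
    rewrite ler_wpM2l ?ler0n // /z exprD ler_wpM2r ?exprn_ge0 ?(ltW e0) //.
    by rewrite lerXn2r // nnegrE; lra.
  have x0 : 0 <= x by apply: le_trans xl; rewrite mulr_ge0 ?ler0n // ltW.
  have /truncn_itv/andP[_] := x0; rewrite -natr1 => /ltW tx.
  have t1 : pi * (D%:R * z) <= pi * ((Num.truncn x)%:R + 1).
    by rewrite ler_wpM2l //; apply: le_trans xl tx.
  rewrite mulrA piD mulrDr mulr1 in t1.
  have : tau + tau = th * z by rewrite /tau; field.
  lra.
have := @mean_potential R V C K g b h m D kappa eps pi hS hd hpi n.
rewrite piD => mp.
have lv : rounds eps pi n (fun w : {set V} * _ => #|live K g b w.1 w.2|%:R) <= (2 * eps) * #|K|%:R.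
  rewrite (exp_ext hE (g := fun w => \sum_(T in K) inside R w.1 (live K g b w.1 w.2) [set T] set0)); last first.
    move=> [X ws] /=; rewrite /inside -natr_sum; congr (_%:R)%R.
    rewrite -sum1_card big_mkcond [RHS]big_mkcond /=; apply: eq_bigr => T _.
    rewrite sub1set sub0set andbT; case: (boolP (T \in live _ _ _ _ _)) => [TL|_].
      by have /subsetP/(_ _ TL)/setDP[-> _] := live_sub K g b X ws.
    by case: ifP.
  rewrite exp_sum // mulr_natr -sumr_const; apply: ler_sum => T TK.
  have dis : [disjoint [set T] & set0] by rewrite disjoint_sym disjoints_subset sub0set.
  have kk : 0 <= kappa <= k1 by rewrite kap0.
  have := Q V C K g b D kappa hS kk D1 [set T] set0.
  rewrite sub1set sub0set cards1 cards0 mulr1 expr1 ler_norml.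
  move=> /(_ TK isT dis erefl erefl) /andP[_]; rewrite -/pi; lra.
pose bad (w : {set V} * seq {set C}) : R := \sum_(Z in ZZ) (Z \subset used w.2)%:R.
have bd : H * rounds eps pi n bad <= eps * #|K|%:R.
  apply: le_trans Zsum; rewrite ler_wpM2l ?ler0n // exp_sum //; apply: ler_sum => Z _.
  apply: le_trans (rounds_used V hd hpi n Z) _.
  by rewrite /pi mulrA.
have k0 : 0 <= #|K|%:R :> R by [].
have nth : n%:R * (H * th ^+ 2) <= eps.
  have n3 : n%:R * th <= 2 / (eps * z) + 1.
    apply: (@le_trans _ _ ((1 / (eps * tau) + 1) * th)); first by rewrite ler_wpM2r // ltW.
    have -> : (1 / (eps * tau) + 1) * th = 2 / (eps * z) + th.
      by rewrite /tau; field; rewrite !gt_eqF.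
    by rewrite lerD2l.
  have -> : n%:R * (H * th ^+ 2) = (n%:R * th) * (H * th) by ring.
  apply: (@le_trans _ _ ((2 / (eps * z) + 1) * (H * th))).
    by rewrite ler_wpM2r // mulr_ge0 ?ltW //; lra.
  rewrite /th le_eqVlt; apply/orP; left; apply/eqP; field.
  rewrite !gt_eqF //; last lra.
  by have := ez0; lra.
have nth' := ler_wpM2r k0 nth.
pose F (w : {set V} * seq {set C}) : R := potential R K g b h w.1 w.2 - #|live K g b w.1 w.2|%:R - H * bad w.
(* The sacrificed sets, the clashes and the forbidden sets cost eps |K| each. The live sets cost 2
   eps |K|, one share for the density and one for the error in [quasi]. *)
have EF : (1 - 5 * eps) * #|K|%:R <= rounds eps pi n F.
  rewrite /F !expB // expZ //; move: mp lv bd nth'; rewrite -/H; lra.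
case: (posnP #|K|) => [K0|Kpos].
  exists set0, set0; rewrite K0 mulr0; split=> [c|c c'|Z ZZZ|]; rewrite ?inE ?mulr_ge0 //.
  by rewrite subset0; apply: contraNneq Z0 => <-.
have [[X ws]] := rounds_exists hd hpi EF; rewrite /F /= => Fw.
have [M [MA Mbad Mcard]] := remove_bad (accepted K g b X ws) Z0.
exists X, M; split=> //.
- by move=> c /(subsetP MA)/accepted_spec[].
- by move=> c c' /(subsetP MA) cM /(subsetP MA) c'M; apply: (accepted_disj cM c'M).
apply: (le_trans Fw); rewrite /potential addrK -/H -mulrBr ler_wpM2l ?ler0n //.
rewrite lerBlDr -(ler_nat R) natrD in Mcard *; apply: le_trans Mcard _.
rewrite lerD2l /bad -natr_sum ler_nat -sum1dep_card big_mkcondr /=.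
apply: leq_sum => Z _; case: ifP => // ZA.
by rewrite (subset_trans ZA (accepted_used K g b X ws)).
Qed.

(** * Sparse packings of gadgets *)

Lemma ffact_ge (n r : nat) : ((n - r) ^ r <= n ^_ r)%N.
Proof.
elim: r n => [|r IH] n; first by rewrite expn0 ffactn0.
case: n => [|n]; first by rewrite sub0n exp0n.
rewrite subSS expnS ffactSS leq_mul ?IH //; lia.
Qed.

Lemma expn_le_ffact (n r : nat) : (2 * r <= n)%N -> (n ^ r <= 2 ^ r * n ^_ r)%N.
Proof.
case: r => [|r] rn; first by rewrite !expn0 ffactn0.
apply: leq_trans (leq_mul (leqnn _) (ffact_ge n r.+1)).
by rewrite -expnMn leq_exp2r //; lia.
Qed.

Lemma sum_by_card (R : realFieldType) (C : finType) (ZZ : {set {set C}}) (J : nat)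
    (F : nat -> R) : (forall Z, Z \in ZZ -> (#|Z| <= J)%N) ->
  \sum_(Z in ZZ) F #|Z| = \sum_(j < J.+1) #|[set Z in ZZ | #|Z| == j]|%:R * F j.
Proof.
move=> ZJ; transitivity (\sum_(Z in ZZ) \sum_(j < J.+1 | #|Z| == j) F j).
  apply: eq_bigr => Z /ZJ ZJ1; rewrite (big_pred1 (inord #|Z|)) ?inordK // => j /=.
  by rewrite -val_eqE /= inordK // eq_sym.
rewrite (exchange_big_dep xpredT) //=; apply: eq_bigr => j _.
by rewrite mulr_natl -sumr_const; apply: eq_bigl => Z; rewrite inE.
Qed.

Section Packing.
Variables (R : archiRealFieldType) (I : finType) (k J : nat) (G : {set {set I}}).
Hypotheses (k0 : (0 < k)%N) (kI : (k < #|I|)%N) (Gk : forall e, e \in G -> #|e| = k).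
Hypothesis G0 : (0 < #|G|)%N.

Section Fixed.
Variable T : finType.
Hypothesis nT : (2 * #|I| <= #|T|)%N.

Let n := #|T|.
Let v := #|I|.
Let h := #|G|.-1.
Let nonG := [set e : {set I} | #|e| == k] :\: G.
(** The number of copies whose shadow contains a given k-set, namely |G| n^_v / C(n, k). *)
Let D := (#|G| * (k`! * (n - k) ^_ (v - k)))%N.

Definition ksets : {set {set T}} := [set W : {set T} | #|W| == k].
Definition shadow (f : copy I T) : {set {set T}} := [set f @: e | e : {set I} in G].
Definition nonshadow (f : copy I T) : {set {set T}} := [set f @: e | e : {set I} in nonG].

Definition codeg_bound : R := ('C(v, k.+1) * k.+1)%:R / (#|G| * (n - k))%:R.

Lemma ffact_split : (n ^_ v = n ^_ k * (n - k) ^_ (v - k))%N.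
Proof.
have vk : (k + (v - k) = v)%N by rewrite subnKC // ltnW.
rewrite -[in LHS]vk; move: (v - k)%N => r.
elim: (k) (n) => [|i IH] [|p]; rewrite ?ffactn0 ?mul1n ?subn0 ?add0n //.
by rewrite addSn !ffactSS IH subSS mulnA.
Qed.

(** Degrees are given by [card_copies_onto] for k-sets. Two distinct k-sets contain k + 1 points
    between them, so the codegree is at most the number of copies onto a (k+1)-set, smaller than D
    by a factor of order n. *)
Lemma shadow_regular : regular_system ksets shadow nonshadow h #|nonG| D codeg_bound.
Proof.
have nk : (k <= n)%N by rewrite /n; lia.
have nk1 : (k.+1 <= n)%N by rewrite /n; lia.
split.
- move=> f; apply/subsetP => _ /imsetP[e eG ->]; by rewrite inE card_copy_im Gk.
- move=> f; apply/subsetP => _ /imsetP[e eG ->].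
  by rewrite inE card_copy_im; move: eG; rewrite !inE => /andP[].
- move=> f; apply/pred0P => W /=; apply/negP => /andP[/imsetP[e eG ->] /imsetP[e' eG' /copy_im_inj ee']].
  by move: eG'; rewrite !inE -ee' eG.
- by move=> f; rewrite card_imset ?prednK //; exact: copy_im_inj.
- by move=> f; rewrite card_imset //; exact: copy_im_inj.
- move=> W; rewrite inE => /eqP Wk; have := card_copies_onto Gk Wk.
  rewrite -/n ffact_split -bin_ffact /copies_onto /shadow => E.
  apply/eqP; rewrite -(eqn_pmul2r (m := 'C(n, k))) ?bin_gt0 // E /D.
  by apply/eqP; ring.
move=> W W'; rewrite !inE => /eqP Wk /eqP W'k WW'.
pose F := [set e : {set I} | #|e| == k.+1].
have Fk e : e \in F -> #|e| = k.+1 by rewrite inE => /eqP.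
have /subsetPn[x xW' xW] : ~~ (W' \subset W).
  apply: contraNN WW' => sub; rewrite eq_sym eqEcard sub Wk W'k leqnn //.
have cU : #|x |: W| = k.+1 by rewrite cardsU1 xW Wk.
have := card_copies_onto Fk cU; rewrite card_draws -/n -/v => E.
have le : (#|[set f | (W \in shadow f) && (W' \in shadow f :|: nonshadow f)]| <=
   #|copies_onto F (x |: W)|)%N.
  apply/subset_leq_card/subsetP => f; rewrite 2!inE => /andP[/imsetP[e eG We] W'f].
  have [e' W'e'] : exists e' : {set I}, W' = copy_fun f @: e'.
    by case/orP: W'f => /imsetP[e' _ ->]; exists e'.
  move: xW'; rewrite W'e' => /imsetP[y _ xy].
  rewrite inE; apply/imsetP; exists (y |: e); last by rewrite imsetU1 -xy -We.
  by rewrite inE -(card_copy_im f) imsetU1 -xy -We cU.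
have E2 : (#|copies_onto F (x |: W)| * (#|G| * (n - k)) = 'C(v, k.+1) * k.+1 * D)%N.
  have := mul_bin_left n k => E3.
  apply/eqP; rewrite -(eqn_pmul2r (m := 'C(n, k))) ?bin_gt0 //; apply/eqP.
  have -> : (#|copies_onto F (x |: W)| * (#|G| * (n - k)) * 'C(n, k)
    = #|copies_onto F (x |: W)| * #|G| * ((n - k) * 'C(n, k)))%N by ring.
  rewrite -E3; have -> : (#|copies_onto F (x |: W)| * #|G| * (k.+1 * 'C(n, k.+1)) =
    (#|copies_onto F (x |: W)| * 'C(n, k.+1)) * (#|G| * k.+1))%N by ring.
  by rewrite E ffact_split -bin_ffact /D; ring.
have pos : 0 < (#|G| * (n - k))%:R :> R by rewrite ltr0n muln_gt0 G0 subn_gt0.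
rewrite /codeg_bound mulrAC ler_pdivlMr // -!natrM ler_nat -E2.
by rewrite leq_mul2r le orbT.
Qed.

Lemma D_ge : (n ^ (v - k) <= 2 ^ (v - k) * D)%N.
Proof.
have : (n ^ (v - k) <= 2 ^ (v - k) * (n - k) ^_ (v - k))%N.
  apply: leq_trans (leq_mul (leqnn _) (ffact_ge _ _)).
  by rewrite -expnMn leq_exp2r ?subn_gt0 //; rewrite /n /v; lia.
move=> /leq_trans; apply; rewrite leq_mul2l /D mulnA leq_pmull ?orbT //.
by rewrite muln_gt0 G0 fact_gt0.
Qed.

Lemma bin_ge : (n ^ k <= 2 ^ k * k`! * 'C(n, k))%N.
Proof.
rewrite -mulnA [(_`! * _)%N]mulnC bin_ffact; apply: expn_le_ffact.
rewrite /n; lia.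
Qed.

(* The collections of at most J copies that overlap more than a tree-like one.
   The empty collection is not dense, since the strict inequality reads 0 < 0. *)
Definition dense : {set {set copy I T}} :=
  [set Z : {set copy I T} | (#|Z| <= J)%N && (#|span Z| + #|Z|.-1 * k < #|Z| * v)%N].

Definition dense_cst (lam : R) : R := \sum_(j < J.+1)
  ((j * (v - k) + k.-1) ^ (j * v))%:R * (lam * (2 ^ (v - k))%:R) ^+ j.

(** A dense collection of j copies spans at most s = j(v-k) + k - 1 points, so there are O(n^s) of
    them. Each has weight O(n^(-j(v-k))), and n^(k-1) remains, which is negligible against C(n,
    k). *)
Lemma dense_sum (lam : R) : 0 < lam ->
  \sum_(Z in dense) (lam / D%:R) ^+ #|Z| <= dense_cst lam * (n ^ k.-1)%:R.
Proof.
move=> lam0; have n0 : (0 < n)%N by rewrite /n; lia.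
have D0 : (0 < D)%N.
  by have := D_ge; rewrite leqNgt; case: (D) => [|//]; rewrite muln0 expn_gt0 n0.
rewrite (sum_by_card (J := J)); last by move=> Z; rewrite inE => /andP[].
rewrite /dense_cst mulr_suml; apply: ler_sum => j _.
set s := (j * (v - k) + k.-1)%N.
have cnt : (#|[set Z in dense | #|Z| == j]| <= s ^ (j * v) * n ^ s)%N.
  apply: leq_trans (card_small_span I j s n0).
  apply/subset_leq_card/subsetP => Z; rewrite !inE => /andP[/andP[_ +] /eqP Zj].
  rewrite Zj eqxx /= /s; case: (nat_of_ord j) => [|i]; first by lia.
  have : (k <= v)%N by rewrite ltnW.
  by move=> kv; rewrite mulnBr !mulSn /=; have := leq_mul (leqnn i) kv; lia.
have LD0 : 0 <= lam / D%:R by rewrite divr_ge0 // ltW.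
apply: (@le_trans _ _ ((s ^ (j * v) * n ^ s)%:R * (lam / D%:R) ^+ j)).
  by rewrite ler_wpM2r ?exprn_ge0 // ler_nat.
rewrite natrM -mulrA -mulrA ler_wpM2l // /s expnD natrM mulrAC ler_wpM2r //.
rewrite mulnC expnM natrX -exprMn_comm; last exact: mulrC.
rewrite lerXn2r ?nnegrE ?mulr_ge0 ?(ltW lam0) ?invr_ge0 //.
rewrite mulrC -mulrA ler_wpM2l ?(ltW lam0) // mulrC ler_pdivrMr ?ltr0n //.
by rewrite -natrM ler_nat D_ge.
Qed.

End Fixed.

Lemma archi_le (x : R) : exists N : nat, forall n, (N <= n)%N -> x <= n%:R.
Proof.
have x1 : 0 <= Num.max 0 x by rewrite le_max lexx.
have /truncn_itv/andP[_ xN] := x1; exists (Num.truncn (Num.max 0 x)).+1 => n Nn.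
apply: le_trans (le_trans (ltW xN) _); first by rewrite le_max lexx orbT.
by rewrite ler_nat.
Qed.

(** The nibble applied to k-sets and copies, with shadows as the sets to cover, non-shadows as the
    sets to sacrifice, and the dense collections as the forbidden ones. *)
Theorem sparse_packing (eps : R) : 0 < eps < 1 -> exists n0 : nat, forall T : finType, (n0 <= #|T|)%N ->
  exists (X : {set {set T}}) (M : {set copy I T}), [/\
    forall f : copy I T, f \in M -> forall e : {set I}, #|e| = k ->
      (f @: e \in X) = (e \notin G),
    forall f f' : copy I T, f \in M -> f' \in M -> f != f' -> forall e e' : {set I},
      e \in G -> e' \in G -> f @: e != f' @: e',
    forall Z : {set copy I T}, Z \subset M -> (#|Z| <= J)%N ->
      (#|Z| * #|I| <= #|span Z| + #|Z|.-1 * k)%N &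
    (1 - eps) * 'C(#|T|, k)%:R <= (#|G| * #|M|)%:R].
Proof.
pose m := #|[set e : {set I} | #|e| == k] :\: G|.
move=> /andP[e0 e1].
have e5 : 0 < eps / 5 < 1 by lra.
have [lam [kap [lam0 kap0 H]]] := nibble #|G|.-1 m e5.
(* The three thresholds make the codegree at most [kap], the product kap D at least 1, and the
   contribution of the dense collections at most eps / 5 times C(n, k). *)
have [N1 HN1] := archi_le (('C(#|I|, k.+1) * k.+1)%:R / kap).
have [N2 HN2] := archi_le ((2 ^ (#|I| - k))%:R / kap).
have [N3 HN3] := archi_le (#|G|%:R * dense_cst lam * (2 ^ k * k`!)%:R / (eps / 5)).
exists (2 * #|I| + (k + N1) + N2 + N3)%N => T nT.
have nI : (2 * #|I| <= #|T|)%N by lia.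
have n0 : (0 < #|T|)%N by lia.
have kT : (k < #|T|)%N by move: (kI) nI; clear; lia.
set n := #|T|.
have GE : #|G|.-1.+1 = #|G| by rewrite prednK.
set D := (#|G| * (k`! * (n - k) ^_ (#|I| - k)))%N.
have D1 : 1 <= kap * D%:R.
  have h2 : (2 ^ (#|I| - k))%:R / kap <= n%:R by apply: HN2; rewrite /n; lia.
  rewrite ler_pdivrMr // in h2.
  have h3 : (n * 1 <= n ^ (#|I| - k))%N.
    have : (0 < #|I| - k)%N by lia.
    by case: (_ - _)%N => // i _; rewrite expnS leq_mul // expn_gt0 n0.
  rewrite muln1 in h3; have h4 := leq_trans h3 (D_ge nI).
  rewrite -/n -/D -(ler_nat R) natrM in h4.
  have P : 0 < (2 ^ (#|I| - k))%:R :> R by rewrite ltr0n expn_gt0.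
  have h5 := ler_wpM2r (ltW kap0) h4.
  rewrite -(ler_pM2l P) mulr1; apply: le_trans h2 _; apply: le_trans h5 _.
  by rewrite le_eqVlt; apply/orP; left; apply/eqP; ring.
have K1 : 0 <= codeg_bound T <= kap.
  rewrite /codeg_bound divr_ge0 //= ler_pdivrMr; last by rewrite ltr0n muln_gt0 G0 subn_gt0 kT.
  have h1 : ('C(#|I|, k.+1) * k.+1)%:R / kap <= (n - k)%:R by apply: HN1; rewrite /n; lia.
  rewrite ler_pdivrMr // in h1.
  apply: le_trans h1 _; rewrite mulrC ler_wpM2l ?(ltW kap0) // ler_nat.
  exact: leq_pmull.
have dsum : #|G|.-1.+1%:R * \sum_(Z in dense T) (lam / D%:R) ^+ #|Z| <= eps / 5 * #|ksets T|%:R.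
  apply: (@le_trans _ _ (#|G|%:R * (dense_cst lam * (n ^ k.-1)%:R))).
    by rewrite GE ler_wpM2l //; apply: dense_sum.
  rewrite /ksets card_draws -/n.
  have h3 : #|G|%:R * dense_cst lam * (2 ^ k * k`!)%:R / (eps / 5) <= n%:R.
    by apply: HN3; rewrite /n; lia.
  rewrite ler_pdivrMr in h3; last by lra.
  have h4 := bin_ge nI; rewrite -/n -(ler_nat R) in h4.
  have P : 0 < (2 ^ k * k`!)%:R :> R by rewrite ltr0n muln_gt0 expn_gt0 fact_gt0.
  rewrite -(ler_pM2l P).
  apply: (@le_trans _ _ (eps / 5 * (n ^ k)%:R)).
    have := ler_wpM2r (ler0n R (n ^ k.-1)) h3.
    have -> : n%:R * (eps / 5) * (n ^ k.-1)%:R = eps / 5 * (n ^ k)%:R :> R.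
      by rewrite -[in RHS](prednK k0) expnS natrM; ring.
    move=> /(le_trans _); apply; rewrite le_eqVlt; apply/orP; left; apply/eqP; ring.
  rewrite [leRHS]mulrCA ler_wpM2l //; first by lra.
  by move: h4; rewrite natrM.
have Z0 : set0 \notin dense T by rewrite inE cards0 mul0n ltn0 andbF.
have [X [M [M1 M2 M3 M4]]] := H _ _ _ _ _ _ _ _ (shadow_regular nI) K1 D1 Z0 dsum.
exists X, M; split.
- move=> f fM e ek; have [/subsetP gX /subsetP bX] := M1 f fM.
  case: (boolP (e \in G)) => eG.
    have /gX : f @: e \in shadow f by apply/imsetP; exists e.
    by rewrite inE => /andP[/negPf].
  by apply: bX; apply/imsetP; exists e; rewrite // !inE eG ek eqxx.
- move=> f f' fM f'M ff' e e' eG e'G; apply/eqP => E.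
  have := M2 f f' fM f'M ff'; rewrite -setI_eq0 => /eqP/setP/(_ (f @: e)).
  rewrite in_setI in_set0 => /negP; apply; apply/andP; split.
    by apply/imsetP; exists e.
  by rewrite E; apply/imsetP; exists e'.
- move=> Z ZM ZJ; rewrite leqNgt; apply/negP => lt.
  by have := M3 Z; rewrite inE ZJ lt => /(_ isT)/negP; apply.
- apply: le_trans (le_trans M4 _); last by rewrite GE natrM.
  by rewrite /ksets card_draws -/n mulrCA divff ?mulr1 ?pnatr_eq0.
Qed.

End Packing.

(** The deletion method for random r-sets: about (M + 1) C(N, k) copies of ['I_r] are expected and
    at most C(N, k) dense collections. Taking all k-subsets of ['I_r] as [G] makes the counts for
    packings applicable. *)
Lemma sparse_family (k r J M : nat) : (0 < k)%N -> (k < r)%N -> (1 < J)%N ->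
  exists N : nat, exists B : {set {set 'I_N}}, [/\
    forall e, e \in B -> #|e| = r,
    forall Z : {set {set 'I_N}}, Z \subset B -> (#|Z| <= J)%N ->
      (#|Z| * r <= #|cover Z| + #|Z|.-1 * k)%N,
    (k <= N)%N & (M * 'C(N, k) <= #|B|)%N].
Proof.
move=> k0 kr J1.
have kI : (k < #|'I_r|)%N by rewrite card_ord.
pose G := [set e : {set 'I_r} | #|e| == k].
have GE : #|G| = 'C(r, k) by rewrite card_draws card_ord.
have G0 : (0 < #|G|)%N by rewrite GE bin_gt0 ltnW.
(* With selection probability lam / D, the expected number of copies is exactly (M + 1) C(N, k). *)
pose lam : rat := (M.+1 * #|G|)%:R.
have lam0 : 0 < lam by rewrite ltr0n muln_gt0.
have [N1 HN1] := archi_le (lam * (2 ^ (r - k))%:R).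
have [N2 HN2] := archi_le (dense_cst 'I_r k J lam * (2 ^ k * k`!)%:R).
pose N := (2 * r + N1 + N2)%N; pose T := 'I_N.
have nT : (2 * #|'I_r| <= #|T|)%N by rewrite !card_ord /N; lia.
have TE : #|T| = N by rewrite card_ord.
have N0 : (0 < N)%N by rewrite /N; lia.
have kN : (k <= N)%N by rewrite /N; lia.
set D := (#|G| * (k`! * (N - k) ^_ (r - k)))%N.
have Dge := D_ge k0 kI G0 nT; rewrite TE card_ord -/D in Dge.
have Dlam : lam <= D%:R.
  have h1 : lam * (2 ^ (r - k))%:R <= N%:R by apply: HN1; rewrite /N; lia.
  have h2 : (N * 1 <= N ^ (r - k))%N.
    have : (0 < r - k)%N by lia.
    by case: (r - k)%N => // i _; rewrite expnS leq_mul // expn_gt0 N0.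
  rewrite muln1 in h2; have := leq_trans h2 Dge; rewrite -(ler_nat rat) => h3.
  have P : 0 < (2 ^ (r - k))%:R :> rat by rewrite ltr0n expn_gt0.
  by rewrite -(ler_pM2r P); apply: le_trans h1 _; rewrite mulrC -natrM.
have D0 : 0 < D%:R :> rat by apply: lt_le_trans Dlam.
pose pi := lam / D%:R.
have hpi : 0 <= pi <= 1.
  by rewrite divr_ge0 ?(ltW lam0) ?(ltW D0) //= ler_pdivrMr // mul1r.
have hE := bern_expectation (copy 'I_r T) hpi.
have Ecard : bern pi (fun Y : {set copy 'I_r T} => #|Y|%:R) = (M.+1 * 'C(N, k))%:R.
  rewrite (exp_ext hE (g := fun Y => \sum_(f : copy 'I_r T) ([set f] \subset Y)%:R)); last first.
    move=> Y; rewrite -natr_sum -sum1_card big_mkcond; congr (_%:R)%R.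
    by apply: eq_bigr => f _; rewrite sub1set; case: (f \in Y).
  rewrite exp_sum // (eq_bigr (fun=> pi)); last by move=> f _; rewrite bern_sub cards1 expr1.
  rewrite sumr_const card_copy TE card_ord -[LHS]mulr_natr /pi.
  have := ffact_split kI T; rewrite TE card_ord => ->.
  rewrite mulrAC -[RHS](mulfK (x := D%:R)) ?gt_eqF // /lam -!natrM; congr (_%:R / _).
  rewrite -bin_ffact /D; ring.
have Ebad := dense_sum J k0 kI G0 nT lam0.
rewrite TE card_ord -/D -/pi in Ebad.
have bad_le : dense_cst 'I_r k J lam * (N ^ k.-1)%:R <= 'C(N, k)%:R.
  have h3 : dense_cst 'I_r k J lam * (2 ^ k * k`!)%:R <= N%:R by apply: HN2; rewrite /N; lia.
  have h4 := bin_ge k0 kI G0 nT; rewrite TE -(ler_nat rat) in h4.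
  have P : 0 < (2 ^ k * k`!)%:R :> rat by rewrite ltr0n muln_gt0 expn_gt0 fact_gt0.
  rewrite -(ler_pM2l P) -natrM; apply: le_trans h4.
  have := ler_wpM2r (ler0n rat (N ^ k.-1)) h3.
  rewrite -natrM -expnS (prednK k0) => /(le_trans _); apply.
  by rewrite le_eqVlt; apply/orP; left; apply/eqP; ring.
have [Y HY] : exists Y : {set copy 'I_r T}, (M * 'C(N, k))%:R <=
    #|Y|%:R - \sum_(Z in dense 'I_r k J T) (Z \subset Y)%:R :> rat.
  apply: bern_exists hpi _; rewrite expB // exp_sum // Ecard.
  rewrite (eq_bigr (fun Z : {set copy 'I_r T} => pi ^+ #|Z|)); last by move=> Z _; rewrite bern_sub.
  rewrite mulSn natrD addrC; have := le_trans Ebad bad_le; lra.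
have Z0 : set0 \notin dense 'I_r k J T by rewrite inE cards0 mul0n ltn0 andbF.
have [Y' [Y'Y Ybad Ycard]] := remove_bad Y Z0.
have Y'card : (M * 'C(N, k) <= #|Y'|)%N.
  have E : (#|[set Z in dense 'I_r k J T | Z \subset Y]|%:R : rat) =
    \sum_(Z in dense 'I_r k J T) (Z \subset Y)%:R.
    rewrite -natr_sum; congr (_%:R)%R; rewrite -sum1dep_card big_mkcondr /=.
    by apply: eq_bigr => Z _; case: (_ \subset _).
  rewrite -(ler_nat rat); apply: le_trans HY _; rewrite -E lerBlDr -natrD ler_nat.
  exact: Ycard.
pose im (f : copy 'I_r T) : {set T} := f @: [set: 'I_r].
have im_card f : #|im f| = r by rewrite card_copy_im cardsT card_ord.
have sparse (Z : {set copy 'I_r T}) : Z \subset Y' -> (#|Z| <= J)%N ->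
    (#|Z| * r <= #|span Z| + #|Z|.-1 * k)%N.
  move=> ZY ZJ; rewrite leqNgt; apply/negP => lt.
  by have := Ybad Z; rewrite inE ZJ card_ord lt ZY => /(_ isT).
(* Two copies with the same image span only r points, while sparsity demands at least 2r - k > r. *)
have im_inj : {in Y' &, injective im}.
  move=> f f' fY f'Y E; apply/eqP; apply: contraT => ff'.
  have := sparse [set f; f']; rewrite subUset !sub1set fY f'Y cards2 ff' => /(_ isT J1).
  rewrite /span big_setU1 ?inE //= big_set1 -!/(im _) E setUid im_card.
  by move: kr; clear; lia.
exists N, (im @: Y'); split=> //.
- by move=> e /imsetP[f _ ->].
- move=> Z ZB ZJ; pose Z' := [set f in Y' | im f \in Z].
  have ZE : Z = im @: Z'.
    apply/setP => e; apply/idP/imsetP => [eZ|[f + ->]]; last by rewrite inE => /andP[].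
    have /imsetP[f fY ef] := subsetP ZB _ eZ; exists f => //; by rewrite inE fY -ef.
  have Z'Y : Z' \subset Y' by apply/subsetP => f; rewrite inE => /andP[].
  have cZ : #|Z| = #|Z'|.
    by rewrite ZE card_in_imset // => f f' /(subsetP Z'Y) ? /(subsetP Z'Y) ?; exact: im_inj.
  have := sparse Z' Z'Y; rewrite -cZ => /(_ ZJ).
  suff -> : span Z' = cover Z by [].
  rewrite ZE /cover /span big_imset // => f f' fZ f'Z.
  by apply: im_inj; apply: (subsetP Z'Y).
- by rewrite card_in_imset.
Qed.

(** Private vertices add one point per edge to both sides of the sparsity bound. Since C(N, k) <=
    |B| / M, the shadow has at most C(r, k-1) + 1/M sets per edge. *)
Lemma gadget (k r J M : nat) : (0 < k)%N -> (k < r)%N -> (1 < J)%N -> (0 < M)%N ->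
  exists (I : finType) (F : {set {set I}}) (x : {set I} -> I), [/\
    [/\ forall a, a \in F -> #|a| = r.+1, forall a, a \in F -> x a \in a &
      forall a b, a \in F -> b \in F -> a != b -> x a \notin b],
    forall Z : {set {set I}}, Z \subset F -> (#|Z| <= J)%N ->
      (#|Z| * r.+1 <= #|cover Z| + #|Z|.-1 * k)%N,
    (0 < #|F|)%N &
    (M * #|kshadow k F| <= #|F| * (M * 'C(r, k.-1) + 1))%N].
Proof.
move=> k0 kr J1 M0; have [N [B [B_card B_sparse kN B_big]]] := sparse_family M k0 kr J1.
exists ('I_N + {set 'I_N})%type, (@pendant _ @: B), (@tip _); split.
- split=> [_ /imsetP[e eB ->]|_ /imsetP[e eB ->]|].
  + by rewrite card_pendant B_card.
  + by rewrite tip_pendant in_pendantr.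
  + move=> _ _ /imsetP[e eB ->] /imsetP[e' e'B ->]; apply: contraNN.
    by rewrite tip_pendant in_pendantr => /eqP ->.
- move=> Z ZF; pose Z' := [set e in B | pendant e \in Z].
  have ZE : Z = @pendant _ @: Z'.
    apply/setP => a; apply/idP/imsetP => [aZ|[e + ->]]; last by rewrite inE => /andP[].
    by have /imsetP[e eB ae] := subsetP ZF _ aZ; exists e; rewrite ?inE ?eB -?ae.
  have Z'B : Z' \subset B by apply/subsetP => e; rewrite inE => /andP[].
  rewrite {}ZE card_imset; last exact: pendant_inj.
  move=> /(B_sparse _ Z'B) le; rewrite cover_pendant mulnS addnC.
  by rewrite addnAC leq_add2r.
- rewrite card_imset; last exact: pendant_inj.
  by apply: leq_trans B_big; rewrite muln_gt0 M0 bin_gt0.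
- have := kshadow_pendant B_card k0; rewrite card_ord card_imset; last exact: pendant_inj.
  move=> le; apply: leq_trans (leq_mul (leqnn M) le) _.
  by rewrite mulnDr mulnDr muln1 mulnCA leq_add.
Qed.

(** * Asymptotics *)

Lemma U_ge (R : archiRealFieldType) (t k : nat) (eps : R) : (2 <= t)%N -> (2 <= k)%N ->
  0 < eps < 1 -> exists n0, forall n, (n0 <= n)%N ->
  (1 - eps) * 'C(n, k)%:R <= ('C((t * k).-1, k.-1)%:R + eps) * (U t.+1 n (t * k))%:R.
Proof.
move=> t2 k2 he; have [e0 e1] := andP he.
(* With 1/M <= eps, the gadget has at most C(tk-1, k-1) + eps shadow sets per edge. *)
have [M0 HM] := archi_le (1 / eps); pose M := M0.+1.
have Me : 1 <= M%:R * eps :> R.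
  by have := HM M (leqnSn _); rewrite ler_pdivrMr.
have tk : ((t * k).-1.+1 = t * k)%N by rewrite prednK // muln_gt0; lia.
have kr : (k < (t * k).-1)%N by have := leq_mul t2 (leqnn k); lia.
have k0 : (0 < k)%N by lia.
pose J := (2 * t).+2.
have [I [F [x [[F_card x_in x_priv] F_sparse F0 Fsh]]]] := gadget k0 kr (isT : (1 < J)%N) (isT : (0 < M)%N).
rewrite tk in F_card F_sparse.
pose G := kshadow k F.
have Gk e : e \in G -> #|e| = k by rewrite inE => /andP[/eqP].
have [a0 a0F] : exists a, a \in F by apply/card_gt0P.
have kI : (k < #|I|)%N.
  by apply: leq_trans (max_card (mem a0)); rewrite F_card //; lia.
have G0 : (0 < #|G|)%N.
  have [|e ea ek] := @subset_of_card _ a0 k; first by rewrite F_card //; lia.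
  by apply/card_gt0P; exists e; rewrite inE ek eqxx; apply/exists_inP; exists a0.
have [n0 H] := sparse_packing J k0 kI Gk G0 he.
exists n0 => n n0n; have [|X [P [P1 P2 P3 P4]]] := H 'I_n; first by rewrite card_ord.
have UP : (#|P| * #|F| <= U t.+1 n (t * k))%N.
  rewrite -(card_placed (X := X) t2 F_card P1 P2).
  apply: (@leq_bigmax_cond _ _ (fun H : {set {set 'I_n}} => #|H|)).
  rewrite (placed_rgraph P F_card) /=.
  exact: (placed_union_free t2 k0 F_card x_in x_priv F_sparse P1 P2 P3).
rewrite card_ord in P4; apply: le_trans P4 _.
(* A packed copy consumes |G| of the k-sets and yields |F| edges, so this ratio converts an almost
   complete packing into a lower bound for [U]. *)
have Gle : #|G|%:R <= #|F|%:R * ('C((t * k).-1, k.-1)%:R + eps) :> R.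
  have Mp : 0 < M%:R :> R by rewrite ltr0n.
  rewrite -(ler_pM2l Mp) -natrM; apply: (@le_trans _ _ (#|F| * (M * 'C((t * k).-1, k.-1) + 1))%:R).
    by rewrite ler_nat.
  rewrite natrM natrD natrM mulrCA ler_wpM2l //; lra.
rewrite natrM; have Pp : 0 <= #|P|%:R :> R by [].
apply: le_trans (ler_wpM2r Pp Gle) _.
rewrite mulrAC mulrC ler_wpM2l ?addr_ge0 ?(ltW e0) //.
by rewrite mulrC -natrM ler_nat.
Qed.

Lemma U_asymptotics (R : archiRealFieldType) (t k : nat) (eps : R) : (2 <= t)%N -> (2 <= k)%N ->
  0 < eps < 1 -> exists n0, forall n, (n0 <= n)%N ->
  (1 - eps) * ((k`!)%:R^-1 * ('C((t * k).-1, k.-1))%:R^-1)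
    <= (U t.+1 n (t * k))%:R / n%:R ^+ k
    <= (k`!)%:R^-1 * (('C((t * k).-1, k.-1))%:R^-1 : R).
Proof.
move=> t2 k2 /andP[e0 e1].
(* Three losses of a factor 1 - eps / 3: the packing, the passage from the falling factorial to n^k,
   and the term eps / 3 next to the binomial coefficient, which is at least 1. Their product is at
   least 1 - eps. *)
have e3 : 0 < eps / 3 < 1 by apply/andP; split; lra.
have [n1 H1] := U_ge t2 k2 e3.
have [n2 H2] := archi_le ((k * k)%:R / (eps / 3)).
exists (n1 + n2 + k.+1)%N => n nn.
have n0 : 0 < n%:R :> R by rewrite ltr0n; lia.
set c := 'C(_, _) in H1 *.
have c1 : 1 <= c%:R :> R.
  by rewrite ler1n bin_gt0; have := leq_mul t2 (leqnn k); lia.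
have f1 : 0 < k`!%:R :> R by rewrite ltr0n fact_gt0.
have nk : 0 < n%:R ^+ k :> R by rewrite exprn_gt0.
have bf : 'C(n, k)%:R * k`!%:R = (n ^_ k)%:R :> R by rewrite -natrM bin_ffact.
(* The ratio is at least (1 - k/n)^k, and Bernoulli's inequality bounds this below by 1 - k^2/n. *)
have L : (1 - eps / 3) * n%:R ^+ k <= (n ^_ k)%:R :> R.
  have kn : (k <= n)%N by lia.
  apply: (@le_trans _ _ ((n - k) ^ k)%:R); last by rewrite ler_nat ffact_ge.
  have h2 : (k * k)%:R / (eps / 3) <= n%:R by apply: H2; lia.
  rewrite ler_pdivrMr in h2; last by lra.
  pose y : R := k%:R / n%:R.
  have y1 : 0 <= y <= 1 by rewrite divr_ge0 //= ler_pdivrMr // mul1r ler_nat.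
  have -> : ((n - k) ^ k)%:R = (1 - y) ^+ k * n%:R ^+ k :> R.
    rewrite natrX natrB // -exprMn_comm; last exact: mulrC.
    by congr (_ ^+ _); rewrite /y; field; rewrite gt_eqF.
  rewrite ler_wpM2r ?(ltW nk) //.
  have yk : k%:R * y <= eps / 3.
    by rewrite /y mulrA -natrM ler_pdivrMr // mulrC.
  apply: (@le_trans _ _ (1 - k%:R * y)); first by lra.
  have {yk} y01 := y1; case/andP: y01 => y0 yle.
  elim: (k) => [|i IHi]; first by rewrite mul0r expr0 subr0.
  rewrite exprS -natr1 mulrDl mul1r.
  have p1 : 0 <= i%:R * y * y by apply: mulr_ge0 => //; apply: mulr_ge0.
  have : (1 - y) * (1 - i%:R * y) <= (1 - y) * (1 - y) ^+ i by rewrite ler_wpM2l // subr_ge0.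
  lra.
apply/andP; split; last first.
  rewrite ler_pdivrMr // -invfM mulrC ler_pdivlMr ?mulr_gt0 ?(lt_le_trans ltr01 c1) //.
  have t0 : (0 < t)%N by lia.
  have k0 : (0 < k)%N by lia.
  have := U_le n t0 k0; rewrite -/c -(ler_nat R) natrM => h.
  have h2 := ler_wpM2r (ltW f1) h; rewrite bf in h2.
  have h3 : (n ^_ k)%:R <= n%:R ^+ k :> R.
    rewrite -natrX ler_nat; elim: (k) (n) => [|i IHi] m; first by rewrite ffactn0.
    rewrite ffactnS expnS leq_mul // (leq_trans (IHi _)) //; case: i {IHi} => // i.
    by rewrite leq_exp2r // leq_pred.
  rewrite mulrA mulrAC; apply: le_trans h2 h3.
rewrite ler_pdivlMr //.
have h := H1 n ltac:(lia).
set u := (U _ _ _)%:R in h *.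
have cp : 0 < c%:R :> R by lra.
have h2 := ler_wpM2r (ltW f1) h; rewrite -mulrA bf in h2.
have h3 : (1 - eps / 3) * ((1 - eps / 3) * n%:R ^+ k) <= (c%:R + eps / 3) * u * k`!%:R.
  by apply: le_trans h2; rewrite ler_wpM2l //; lra.
have u0 : 0 <= u by [].
have h4 : (1 - eps / 3) * (c%:R + eps / 3) <= c%:R.
  have : 0 <= (eps / 3) * (c%:R - 1) by rewrite mulr_ge0 // ?subr_ge0 //; lra.
  have : 0 <= (eps / 3) * (eps / 3) by rewrite mulr_ge0 //; lra.
  lra.
have uf : 0 <= u * k`!%:R by rewrite mulr_ge0 // ltW.
have h5 := ler_wpM2r uf h4.
have q0 : 0 <= 1 - eps / 3 by lra.
have h6 := ler_wpM2l q0 h3.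
have e9 : 1 - eps <= (1 - eps / 3) ^+ 3.
  have a1 : 0 <= (eps / 3) ^+ 2 * (3 - eps / 3) by rewrite mulr_ge0 ?sqr_ge0 //; lra.
  by rewrite !exprS expr0 in a1 *; lra.
have h7 : (1 - eps) * n%:R ^+ k <= c%:R * (u * k`!%:R).
  apply: le_trans h5; apply: (@le_trans _ _ ((1 - eps / 3) ^+ 3 * n%:R ^+ k)).
    by rewrite ler_wpM2r // ltW.
  by move: h6; rewrite !exprS expr0 mulr1 !mulrA.
have -> : (1 - eps) * (k`!%:R^-1 / c%:R) * n%:R ^+ k = ((1 - eps) * n%:R ^+ k) / (c%:R * k`!%:R).
  by field; rewrite !gt_eqF.
rewrite ler_pdivrMr ?mulr_gt0 //; apply: le_trans h7 _.
by rewrite le_eqVlt; apply/orP; left; apply/eqP; ring.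
Qed.

(* The limit *)
From mathcomp Require Import all_classical all_reals all_analysis.
Import numFieldNormedType.Exports.

Local Open Scope classical_set_scope.
Local Open Scope ring_scope.

Theorem theorem1p2 (R : realType) (t k : nat) (ht : (2 <= t)%N)
    (hk : (2 <= k)%N) :
  ((U t.+1 n (t * k)%N)%:R / n%:R ^+ k : R) @[n --> \oo] -->
    ((k`!)%:R^-1 * ('C((t * k).-1, k.-1))%:R^-1 : R).
Proof.
apply/cvgrPdist_le => e e0.
(* The cap 1/2 keeps the relative error below 1. As the limit is at most 1, a relative error of d is
   an absolute error of at most e. *)
pose d : R := Num.min e (1 / 2).
have d01 : 0 < d < 1.
  rewrite lt_min e0 divr_gt0 //= gt_min; apply/orP; right; lra.
have [n0 H] := U_asymptotics ht hk d01.
exists n0 => // n /= n0n; have /andP[lo hi] := H n n0n.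
rewrite ger0_norm ?subr_ge0 //.
set L := (k`!)%:R^-1 * _ in lo hi *.
have L01 : 0 <= L <= 1.
  have c0 : (0 < 'C((t * k).-1, k.-1))%N.
    by rewrite bin_gt0; have := leq_mul ht (leqnn k); lia.
  have inv01 (i : nat) : (0 < i)%N -> 0 <= (i%:R : R)^-1 <= 1.
    by move=> i0; rewrite invr_ge0 ler0n /= invf_le1 ?ltr0n // ler1n.
  have /andP[u0 u1] := inv01 _ (fact_gt0 k); have /andP[v0 v1] := inv01 _ c0.
  by apply/andP; split; [apply: mulr_ge0 | apply: mulr_ile1].
have de : d <= e by rewrite ge_min lexx.
have dL : d * L <= e.
  apply: le_trans de; rewrite ler_piMr //; last by case/andP: L01.
  by case/andP: d01 => /ltW.
by move: lo; rewrite mulrBl mul1r; lra.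
Qed.
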